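(* Let $T$ be an automorphism of a standard probability Borel space $(X,\mathcal{B},\mu)$, $G$ a second countable locally compact Abelian group, $\varphi:X\to G$ a measurable map, $\mathcal{S}=(S_g)_{g\in G}$ a $G$-action on a standard probability Borel space $(Y,\mathcal{C},\nu)$, and $T_{\varphi,\mathcal{S}}(x,y)=(Tx,S_{\varphi(x)}(y))$ on $(X\times Y,\mathcal{B}\otimes\mathcal{C},\mu\otimes\nu)$. Assume that $T_{\varphi,\mathcal{S}}$ is ergodic. Then the eigenfunctions of $T_{\varphi,\mathcal{S}}$ are the functions of the form $f\otimes g$ (i.e. $(x,y)\mapsto f(x)g(y)$), where $\chi\circ\varphi=e^{2\pi i t}\cdot f/f\circ T$ ($\mu$-a.e.) for some measurable $f:X\to\mathbb{T}$ and $t\in[0,1)$, $\chi\in\widehat{G}$ is an eigenvalue of $\mathcal{S}$, and $g$ is an eigenfunction of $\mathcal{S}$ corresponding to $\chi$. In particular, for $t\in[0,1)$, $e^{2\pi i t}$ is an eigenvalue of $T_{\varphi,\mathcal{S}}$ if and only if there exists an eigenvalue of $\mathcal{S}$ in $A_t$.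
   Context: An automorphism is an invertible measure-preserving transformation. A $G$-action is a measurable group homomorphism $g\mapsto S_g\in\mathrm{Aut}(Y,\mathcal{C},\nu)$. $\mathbb{T}=\{z\in\mathbb{C}:|z|=1\}$. A character $\chi\in\widehat{G}$ is an eigenvalue of $\mathcal{S}$, with eigenfunction $g$, if $0\neq g\in L^2(Y,\mathcal{C},\nu)$ and $g\circ S_h=\chi(h)g$ for all $h\in G$ (so the trivial character, with constants as eigenfunctions, is an eigenvalue). An eigenfunction of $T_{\varphi,\mathcal{S}}$ with eigenvalue $c\in\mathbb{T}$ is a non-zero $F\in L^2(X\times Y,\mu\otimes\nu)$ with $F\circ T_{\varphi,\mathcal{S}}=cF$. For $t\in[0,1)$, $$A_t=\{\chi\in\widehat{G}:\ \chi\circ\varphi=e^{2\pi i t}\cdot\xi/\xi\circ T\ \ \mu\text{-a.e. for some measurable }\xi:X\to\mathbb{T}\},$$ the set of $\chi$ such that $\chi\circ\varphi$ is cohomologous to the constant $e^{2\pi it}$. *)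

(* Defs.v *)
From HB Require Import structures.
From mathcomp Require Import all_boot all_order all_algebra.
From mathcomp Require Import complex.
From mathcomp Require Import all_classical all_reals all_analysis.
From mathcomp Require Import measurable_realfun.

Set Implicit Arguments.
Unset Strict Implicit.
Unset Printing Implicit Defensive.

Import Order.TTheory GRing.Theory Num.Theory.
Import numFieldNormedType.Exports.

Local Open Scope classical_set_scope.
Local Open Scope ring_scope.

(* The alias supplies the base point 0, which [g_sigma_algebraType] needs and
   which a [topologicalZmodType] does not carry canonically. *)
Definition pointed_zmod (G : topologicalZmodType) : Type := G.
HB.instance Definition _ (G : topologicalZmodType) :=
  Choice.on (pointed_zmod G).
HB.instance Definition _ (G : topologicalZmodType) :=
  isPointed.Build (pointed_zmod G) (0 : G).

(* [G], respectively the complex field over [R], with its Borel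
   sigma-algebra. *)
Notation borel G :=
  (g_sigma_algebraType (@open G : set (set (pointed_zmod G)))).
Notation borelC R := (g_sigma_algebraType (@open (complex R)^o)).

(* The measurable sets of [T] are the Borel sets of a complete separable
   metric: a Hausdorff pseudometric is a metric, and a metric space is
   separable iff it is second countable. *)
Definition standard_borel (R : realType) d (T : measurableType d) : Prop :=
  exists (P : completePseudoMetricType R) (h : T -> P),
    [/\ hausdorff_space P, @second_countable P, bijective h &
        (measurable : set (set T)) = [set h @^-1` B | B in <<s @open P >>]].

Section transformations.
Context d (T : measurableType d) (R : realType).
Variable m : {measure set T -> \bar R}.

Definition measure_preserving (f : T -> T) : Prop :=
  measurable_fun [set: T] f /\
  forall A, measurable A -> m (f @^-1` A) = m A.

(* Transformations are regarded modulo null sets, so that invertibility means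
   having an almost everywhere inverse. *)
Definition automorphism (f : T -> T) : Prop :=
  measure_preserving f /\
  exists g : T -> T, [/\ measure_preserving g,
    {ae m, forall x, g (f x) = x} & {ae m, forall x, f (g x) = x}].

Definition ergodic (f : T -> T) : Prop :=
  measure_preserving f /\
  forall A, measurable A -> f @^-1` A = A -> m A = 0%E \/ m (~` A) = 0%E.

(* Functions representing elements of the complex space L^2(m). *)
Definition L2 (F : T -> R[i]) : Prop :=
  measurable_fun [set: T] (F : T -> borelC R) /\
  (\int[m]_x (complex.Re `|F x| ^+ 2)%:E < +oo)%E.

Definition nonzero (F : T -> R[i]) : Prop := ~ {ae m, forall x, F x = 0}.

Definition eigenfunction (f : T -> T) (c : R[i]) (F : T -> R[i]) : Prop :=
  [/\ `|c| = 1, L2 F, nonzero F & {ae m, forall x, F (f x) = c * F x}].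

Definition L2_eigenvalue (f : T -> T) (c : R[i]) : Prop :=
  exists F, eigenfunction f c F.

End transformations.

Section actions.
Context d (Y : measurableType d) (R : realType) (G : topologicalZmodType).
Variables (nu : probability Y R) (S : G -> Y -> Y).

(* A measurable group homomorphism from [G] to Aut(Y, nu). Equality in Aut is
   equality almost everywhere. The Borel sigma-algebra of the weak topology of
   Aut is generated by the maps [f |-> nu (f^-1 A `&` B)], [A] and [B]
   measurable, whence the last condition. Joint measurability of
   [(g, y) |-> S g y] is not required. *)
Definition measurable_action : Prop :=
  [/\ forall g, automorphism nu (S g),
      forall g h, {ae nu, forall y, S (g + h) y = S g (S h y)} &
      forall A B, measurable A -> measurable B ->
        measurable_fun [set: borel G]
          ((fun g => nu (S g @^-1` A `&` B)) : borel G -> \bar R)].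

Definition character (chi : G -> R[i]) : Prop :=
  [/\ continuous (chi : G -> R[i]^o), forall g, `|chi g| = 1 &
      forall g h, chi (g + h) = chi g * chi h].

Definition action_eigenfunction (chi : G -> R[i]) (g : Y -> R[i]) : Prop :=
  [/\ character chi, L2 nu g, nonzero nu g &
      forall h, {ae nu, forall y, g (S h y) = chi h * g y}].

Definition action_eigenvalue (chi : G -> R[i]) : Prop :=
  exists g, action_eigenfunction chi g.

End actions.

Section skew_products.
Context dX (X : measurableType dX) (R : realType) (G : topologicalZmodType).
Variables (mu : probability X R) (T : X -> X) (phi : X -> G).

Definition skew_product (Y : Type) (S : G -> Y -> Y) (p : X * Y) : X * Y :=
  (T p.1, S (phi p.1) p.2).

(* The point e^{2 pi i t} of the unit circle. *)
Definition cis2pi (t : R) : R[i] :=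
  Complex (cos (2 * pi * t)) (sin (2 * pi * t)).

(* [chi \o phi] is cohomologous to the constant e^{2 pi i t} by means of the
   measurable transfer function [xi], with values in the unit circle. *)
Definition cohomologous_via (t : R) (chi : G -> R[i]) (xi : X -> R[i]) : Prop :=
  [/\ measurable_fun [set: X] (xi : X -> borelC R), forall x, `|xi x| = 1 &
      {ae mu, forall x, chi (phi x) = cis2pi t * (xi x / xi (T x))}].

Definition cohomologous_characters (t : R) : set (G -> R[i]) :=
  [set chi | character chi /\ exists xi, cohomologous_via t chi xi].

End skew_products.

(* Main.v *)
Require Import Defs.
From HB Require Import structures.
From mathcomp Require Import all_boot all_order all_algebra.
From mathcomp Require Import complex.
From mathcomp Require Import all_classical all_reals all_analysis.
From mathcomp Require Import measurable_realfun.
From mathcomp Require Import ring lra.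
Set Implicit Arguments.
Unset Strict Implicit.
Unset Printing Implicit Defensive.
Import Order.TTheory GRing.Theory Num.Theory.
Import numFieldNormedType.Exports.
Local Open Scope classical_set_scope.
Local Open Scope ring_scope.

(* An eigenfunction F has constant modulus, so it may be taken unimodular. Since
   G is Abelian, the fiber maps (x, y) |-> (x, S_g y) commute with the skew
   product; eigenvalues of an ergodic map being simple, F (x, S_g y) =
   chi g * F (x, y). Hence each q_A y = \int_A F (x, y) dmu(x) is either 0 or an
   eigenfunction of S for chi, and some q = q_A is nonzero because F is. By
   ergodicity |q| is constant, and F (x, y) * conj (q y), being invariant under
   all fiber maps, is a function of x alone: this is the factorisation of F.
   The character chi is Borel measurable, as its values are correlations of q
   under S; a Baire category argument makes it continuous. *)

(** * Baire category and automatic continuity *)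

(** Everything known about [S] holds for one group element at a time, off a null set depending on
    it, whereas the skew product applies [S (phi x)] with x varying. Facts are therefore carried to
    the product fiber by fiber: a measurable set of pairs whose sections over all x are conull is
    conull, and its measurability is drawn from that of the skew product, which ergodicity includes.
    For the same reason the sections F (x, .) are not treated one x at a time as eigenfunctions of
    [S]: the exceptional x would depend on g. Integrating over A removes x beforehand. A whole
    family of A is used because a single integral, say over all of [X], may vanish although F does
    not; rectangles generate the product sigma-algebra, so some A works. Continuity of chi goes
    through category rather than Haar measure: a locally compact Hausdorff group is a Baire space,
    and its Borel sets have the Baire property. *)

Definition residual {T : topologicalType} (A : set T) : Prop :=
  exists U : nat -> set T,
    (forall n, open (U n) /\ dense (U n)) /\ \bigcap_n U n `<=` A.

Lemma residualS {T : topologicalType} (A B : set T) :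
  A `<=` B -> residual A -> residual B.
Proof. by move=> AB [U [oU UA]]; exists U; split=> //; exact: subset_trans AB. Qed.

Lemma open_dense_residual {T : topologicalType} (A : set T) :
  open A -> dense A -> residual A.
Proof. by move=> oA dA; exists (fun=> A); split=> // x /(_ 0%N I). Qed.

Lemma residual_bigcap {T : topologicalType} (A : nat -> set T) :
  (forall n, residual (A n)) -> residual (\bigcap_n A n).
Proof.
move=> /choice[U UP].
(* The doubly indexed family is enumerated by coding pairs; the default [(0, 0)] merely repeats a
   member of it. *)
exists (fun k => let p := odflt (0, 0)%N (unpickle k) in U p.1 p.2); split.
  by move=> k; exact: (UP _).1.
move=> x xU n _; apply: (UP n).2 => k _.
by have := xU (pickle (n, k)) I; rewrite /= pickleK.
Qed.

Lemma residualI {T : topologicalType} (A B : set T) :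
  residual A -> residual B -> residual (A `&` B).
Proof.
move=> rA rB; have := @residual_bigcap _ (fun n => if n is 0%N then A else B).
move=> /(_ _)/residualS; apply; last by case.
by move=> x xAB; split; [exact: (xAB 0%N)|exact: (xAB 1%N)].
Qed.

Lemma continuous_addr {G : topologicalZmodType} (h : G) :
  continuous (fun x : G => x + h).
Proof.
move=> x; apply: (@continuous_comp _ _ _ (fun x => (x, h))
  (fun p : G * G => p.1 + p.2)); last exact: add_continuous.
by apply: cvg_pair; [exact: cvg_id|exact: cvg_cst].
Qed.

Lemma residual_shift {G : topologicalZmodType} (g : G) (A : set G) :
  residual A -> residual [set x | A (x + g)].
Proof.
have cadd := @continuous_addr G.
move=> [U [oU UA]]; exists (fun n => [set x | U n (x + g)]); split; last first.
  by move=> x xU; apply: UA => n _; exact: xU.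
move=> n; split.
  exact: (open_comp (fun x _ => cadd g x) (oU n).1).
move=> O [x Ox] oO; have := (oU n).2 [set y | O (y - g)].
case.
- by exists (x + g) => /=; rewrite addrK.
- exact: (open_comp (fun x _ => cadd (- g) x) oO).
- by move=> y [/= Oy Uy]; exists (y - g); split => //=; rewrite subrK.
Qed.

(** One step of the Baire construction. Compact Hausdorff neighbourhoods are regular, which gives a
    closed neighbourhood inside [W]; its interior provides the open [V]. *)
Lemma locally_compact_shrink {T : topologicalType} (W : set T) :
  hausdorff_space T -> locally_compact [set: T] -> open W -> W !=set0 ->
  exists V, [/\ open V, V !=set0, closure V `<=` W & compact (closure V)].
Proof.
move=> hT lT oW [x Wx].
have [K + [cK clK]] := lT x I; rewrite withinET => Kx.
have WKx : nbhs x (W `&` K) by apply: filterI => //; exact: open_nbhs_nbhs.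
have [V Vx VWK] := compact_regular hT cK Kx WKx.
have cVW : closure V° `<=` W `&` K.
  exact: subset_trans (closureS (@interior_subset _ V)) VWK.
exists V°; split.
- exact: open_interior.
- by exists x; exact: nbhs_singleton (nbhs_interior Vx).
- by move=> y /cVW[].
- by apply: (subclosed_compact _ cK) => [|y /cVW[]//]; exact: closed_closure.
Qed.

(** The Baire category theorem for locally compact Hausdorff spaces: open sets are nested so that
    each closure lies in the previous set and in the next dense open set, and compactness gives a
    common point. *)
Lemma baire_residual_meets_open {T : topologicalType} (A W : set T) :
  hausdorff_space T -> locally_compact [set: T] -> residual A ->
  open W -> W !=set0 -> (W `&` A) !=set0.
Proof.
move=> hT lT [U [oU UA]] oW W0.
pose Q (V : set T) := [/\ open V, V !=set0 & compact (closure V)].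
have [V0 [oV0 V00 V0W cV0]] := locally_compact_shrink hT lT oW W0.
have step (n : nat) (V : {V | Q V}) :
    {V' : {V | Q V} | closure (sval V') `<=` sval V `&` U n}.
  apply: cid; case: V => V [oV V00' cV].
  have VU : (V `&` U n) !=set0 by exact: (oU n).2.
  have [V' [oV' V'0 V'V cV']] := locally_compact_shrink hT lT
    (openI oV (oU n).1) VU.
  have QV' : Q V' by split.
  by exists (exist _ V' QV').
have QV0 : Q V0 by split.
pose V := fix V n := if n is m.+1 then sval (step m (V m)) else exist _ V0 QV0.
have VS n : closure (sval (V n.+1)) `<=` sval (V n) `&` U n.
  by rewrite /=; case: (step n (V n)).
have decr n m : (n <= m)%N -> sval (V m) `<=` sval (V n).
  elim: m => [|m IH]; first by rewrite leqn0 => /eqP ->.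
  rewrite leq_eqVlt => /predU1P[->//|/IH h] x Vx.
  by apply: h; exact: (VS m x (subset_closure Vx)).1.
suff [x xV] : \bigcap_n closure (sval (V n)) !=set0.
  exists x; split; first by apply: V0W; exact: (xV 0%N).
  by apply: UA => n _; exact: (VS n x (xV n.+1 I)).2.
have cl n m : (n <= m)%N -> closure (sval (V m)) `<=` closure (sval (V n)).
  by move=> nm; apply: closureS; exact: decr.
(* The nested closures generate a proper filter containing the compact set [closure V0]; a cluster
   point of it lies in every closed member. *)
pose F := filter_from setT (fun n => closure (sval (V n))).
have FF : ProperFilter F.
  apply: filter_from_proper => [|n _]; last first.
    by case: (V n) => /= S [_ [y Sy] _]; exists y; exact: subset_closure.
  apply: filter_from_filter; first by exists 0%N.
  move=> n m _ _; exists (maxn n m) => // x xV.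
  by split; apply: cl xV; rewrite (leq_maxl, leq_maxr).
have FV0 : F (closure V0) by exists 0%N.
have [x [_ cx]] := cV0 F FF FV0.
exists x => n _.
have : closure (closure (sval (V n))) x.
  by move=> N Nx; apply: cx => //; exists n.
by rewrite -(closure_id _).1 //; exact: closed_closure.
Qed.

(** Having a meagre symmetric difference with an open set, phrased as agreement of the two
    memberships on a residual set. *)
Definition baire_property {T : topologicalType} (A : set T) : Prop :=
  exists2 U, open U & residual [set x | A x <-> U x].

(** The complement is approximated by the exterior of [U]. What [U] and its exterior both miss is
    the boundary of an open set, which is nowhere dense. *)
Lemma baire_propertyC {T : topologicalType} (A : set T) :
  baire_property A -> baire_property (~` A).
Proof.
move=> [U oU rU]; exists (~` U)°; first exact: open_interior.
have : residual (U `|` (~` U)°).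
  apply: open_dense_residual; first by apply: openU => //; exact: open_interior.
  move=> O O0 oO; have [[x [Ox Ux]]|OU] := pselect ((O `&` U) !=set0).
    by exists x; split => //; left.
  have [x Ox] := O0; exists x; split => //; right.
  rewrite /interior nbhsE; exists O => // y Oy Uy.
  by apply: OU; exists y.
move=> /(residualI rU); apply: residualS => x [/= AU].
have iU := @interior_subset _ (~` U) x.
case=> h; split=> [nA|/iU nU /AU//].
- by case: nA; exact/AU.
- exact: h.
Qed.

Lemma baire_property_bigcup {T : topologicalType} (A : nat -> set T) :
  (forall n, baire_property (A n)) -> baire_property (\bigcup_n A n).
Proof.
move=> /(_ _)/cid2-/all_sig2[U oU /residual_bigcap rU].
exists (\bigcup_n U n); first by apply: bigcup_open => n _.
apply: residualS rU => x xU /=.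
by split=> -[n _ ?]; exists n => //; apply/(xU n I).
Qed.

Lemma borel_baire_property {T : topologicalType} (A : set T) :
  <<s @open T >> A -> baire_property A.
Proof.
move=> /(_ baire_property); apply; split=> [|O oO].
  split.
  - by exists set0; [exact: open0|exists (fun=> setT); split=> // n;
      split; [exact: openT|move=> O O0 oO; rewrite setIT]].
  - by move=> B; rewrite setTD; exact: baire_propertyC.
  - exact: baire_property_bigcup.
by exists O => //; exists (fun=> setT); split=> // n;
  split; [exact: openT|move=> S S0 oS; rewrite setIT].
Qed.

(** Pettis' theorem, the category analogue of Steinhaus'. [E] agrees on a residual set with an open
    [U] containing some [u]. If [h + u] is in [U], then [U] and its translate by [- h] overlap in a
    nonempty open set, where some [x] has both [x] and [x + h] in [E]; so [h] is a difference. *)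
Lemma pettis_nbhs0_diff {G : topologicalZmodType} (E : set G) :
  hausdorff_space G -> locally_compact [set: G] ->
  <<s @open G >> E -> ~ residual (~` E) ->
  nbhs (0 : G) [set a - b | a in E & b in E].
Proof.
move=> hG lG /borel_baire_property[U oU rU] nE.
have [u Uu] : U !=set0.
  apply/set0P/eqP => U0; apply: nE; apply: residualS rU => x /=.
  by rewrite U0 => -[+ _].
have cadd := @continuous_addr G.
have : nbhs (0 : G) [set h | U (h + u)].
  by apply: cadd; rewrite add0r; exact: open_nbhs_nbhs.
apply: filterS => h /=; rewrite addrC => Uuh.
have [||x [[Ux Uxh] [/= Ex Exh]]] :=
  baire_residual_meets_open (W := U `&` [set x | U (x + h)]) hG lG
    (residualI rU (residual_shift h rU)).
- by apply: openI => //; exact: (open_comp (fun x _ => cadd h x) oU).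
- by exists u.
exists (x + h); first exact/Exh.
by exists x; [exact/Ex|rewrite addrC addKr].
Qed.

Lemma normC_le_Re_Im {R : realType} (z : R[i]) :
  complex.Re `|z| <= `|complex.Re z| + `|complex.Im z|.
Proof.
rewrite normc_def /= -[leRHS]ger0_norm ?addr_ge0// -sqrtr_sqr ler_sqrt ?sqr_ge0//.
rewrite sqrrD !real_normK ?num_real// lerD2r lerDl.
by rewrite mulrn_wge0// mulr_ge0.
Qed.

(** In the partial order of [R[i]], [0 < e] makes [e] real, so comparing real parts is enough. *)
Lemma normC_lt {R : realType} (z e : R[i]) :
  0 < e -> complex.Re `|z| < complex.Re e -> `|z| < e.
Proof.
case: e => [a b]; rewrite !ltcE /= => /andP[/eqP -> _] h.
by rewrite eqxx.
Qed.

(** Continuity at 0 suffices for a homomorphism. Countably many preimages of small squares cover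
    [G], so one of them is not meagre, and its differences fill a neighbourhood of 0 on which [chi]
    is close to 1. *)
Lemma measurable_hom_continuous {R : realType} {G : topologicalZmodType}
    (chi : G -> R[i]) :
  hausdorff_space G -> locally_compact [set: G] ->
  (forall g, `|chi g| = 1) -> (forall g h, chi (g + h) = chi g * chi h) ->
  measurable_fun [set: borel G] ((fun g => complex.Re (chi g)) : borel G -> R) ->
  measurable_fun [set: borel G] ((fun g => complex.Im (chi g)) : borel G -> R) ->
  continuous (chi : G -> R[i]^o).
Proof.
move=> hG lG chi1 chiD mRe mIm.
have unit_chi g : chi g != 0 by rewrite -normr_eq0 chi1 oner_eq0.
have chi0 : chi 0 = 1.
  by apply: (mulIf (unit_chi 0)); rewrite -chiD addr0 mul1r.
suff near1 (e : R) : 0 < e -> nbhs (0 : G) [set h | complex.Re `|chi h - 1| < e].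
  move=> g; apply/cvgrPdist_lt => e e0.
  have e0' : 0 < complex.Re e by case: e e0 => a b; rewrite ltcE => /andP[].
  have Hn : nbhs (0 : G) [set h | `|chi h - 1| < e].
    by apply: filterS (near1 _ e0') => h; exact: normC_lt.
  have Hc : (fun x : G => x - g) @ g --> (0 : G).
    by rewrite -(subrr g); exact: (@continuous_addr _ (- g) g).
  have Hg : nbhs g [set x | `|chi (x - g) - 1| < e] := Hc _ Hn.
  apply: filterS Hg => h /=.
  have -> : chi (h - g) = chi h / chi g.
    by apply: (mulIf (unit_chi g)); rewrite -chiD subrK divfK.
  rewrite -(divff (unit_chi g)) -mulrBl normrM normfV chi1 invr1 mulr1.
  by rewrite distrC.
(* Two points of the same [E q] have real parts, and imaginary parts, less than [2 * d] apart; the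
   norm is at most the sum of the two gaps, hence [4 * d]. *)
move=> e0; pose d := e / 4.
have d0 : 0 < d by rewrite divr_gt0.
pose E (q : rat * rat) : set G := [set h |
  `|complex.Re (chi h) - ratr q.1| < d /\ `|complex.Im (chi h) - ratr q.2| < d].
have mE q : <<s @open G >> (E q).
  have := @measurableI _ (borel G)
   (setT `&` (fun g => complex.Re (chi g)) @^-1` ball (ratr q.1 : R) d)
   (setT `&` (fun g => complex.Im (chi g)) @^-1` ball (ratr q.2 : R) d).
  rewrite !setTI (_ : _ `&` _ = E q); last first.
    by apply/seteqP; split => x [] /=; rewrite !/ball /= => A B; split;
      rewrite // distrC.
  apply.
  - by rewrite -[X in measurable X]setTI; apply: mRe => //; exact: measurable_ball.
  - by rewrite -[X in measurable X]setTI; apply: mIm => //; exact: measurable_ball.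
(* Otherwise all the complements, hence their intersection, would be residual and contain a point,
   although the squares with rational centres cover the plane. *)
have [q nE] : exists q, ~ residual (~` E q).
  apply/existsNP => rE.
  have := @residual_bigcap _ (fun n => if unpickle n is Some q then ~` E q else setT).
  case.
    move=> n; case: unpickle => [q|]; first exact: rE.
    apply: open_dense_residual; first exact: openT.
    by move=> O O0 oO; rewrite setIT.
  move=> U [oU UE].
  have [x [_ Ux]] := baire_residual_meets_open (W := setT) hG lG
    (ex_intro _ U (conj oU UE)) openT (ex_intro _ 0 I).
  have near_rat (r : R) : exists q : rat, ratr q \in `]r - d, r + d[.
    by apply: rat_in_itvoo; lra.
  have [r1 r1P] := near_rat (complex.Re (chi x)).
  have [r2 r2P] := near_rat (complex.Im (chi x)).
  have := Ux (pickle (r1, r2)) I; rewrite pickleK; apply; split => /=.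
    by rewrite distrC ltr_distl; move: r1P; rewrite in_itv.
  by rewrite distrC ltr_distl; move: r2P; rewrite in_itv.
apply: filterS (pettis_nbhs0_diff hG lG (mE q) nE) => h [a [aR aI] [b [bR bI] <-]].
rewrite /mkset; have -> : chi (a - b) - 1 = (chi a - chi b) / chi b.
  rewrite mulrBl divff//; congr (_ - _).
  by apply: (mulIf (unit_chi b)); rewrite -chiD subrK divfK.
rewrite normrM normfV chi1 invr1 mulr1.
apply: le_lt_trans (normC_le_Re_Im _) _.
have -> : complex.Re (chi a - chi b) = complex.Re (chi a) - complex.Re (chi b).
  by rewrite raddfB.
have -> : complex.Im (chi a - chi b) = complex.Im (chi a) - complex.Im (chi b).
  by rewrite raddfB.
move: aR aI bR bI; rewrite /d.
move: (complex.Re (chi a)) (complex.Re (chi b)) => x y.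
move: (complex.Im (chi a)) (complex.Im (chi b)) => z t.
rewrite !ltr_norml => /andP[? ?] /andP[? ?] /andP[? ?] /andP[? ?].
apply: (@lt_le_trans _ _ (e / 2 + e / 2)); last by lra.
by apply: ltrD; rewrite ltr_norml; apply/andP; split; lra.
Qed.

(** * Ergodicity modulo null sets *)

Section bounded_measurable.
Context d (T : measurableType d) (R : realType).
Implicit Types u v : T -> R.

(** The bound holds everywhere, not almost everywhere: the class is then stable under composition
    with any measurable map, and contains all sections of its members on a product. *)
Definition bounded_measurable u : Prop :=
  measurable_fun [set: T] u /\ exists M, forall x, `|u x| <= M.

Lemma bounded_measurable_cst c : bounded_measurable (fun=> c).
Proof. by split; [exact: measurable_cst|exists `|c|]. Qed.

Lemma bounded_measurableD u v : bounded_measurable u -> bounded_measurable v ->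
  bounded_measurable (fun x => u x + v x).
Proof.
move=> [mu [M uM]] [mv [N vN]]; split; first exact: measurable_funD.
by exists (M + N) => x; rewrite (le_trans (ler_normD _ _))// lerD.
Qed.

Lemma bounded_measurableM u v : bounded_measurable u -> bounded_measurable v ->
  bounded_measurable (fun x => u x * v x).
Proof.
move=> [mu [M uM]] [mv [N vN]]; split; first exact: measurable_funM.
by exists (M * N) => x; rewrite normrM ler_pM.
Qed.

Lemma bounded_measurableB u v : bounded_measurable u -> bounded_measurable v ->
  bounded_measurable (fun x => u x - v x).
Proof.
move=> bu bv; rewrite (_ : (fun x => _) = (fun x => u x + -1 * v x)).
  by apply: bounded_measurableD => //; apply: bounded_measurableM => //;
    exact: bounded_measurable_cst.
by apply/funext => x; rewrite mulN1r.
Qed.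

Lemma bounded_measurable_indic (A : set T) :
  measurable A -> bounded_measurable (\1_A : T -> R).
Proof.
move=> mA; split; first exact: measurable_indic.
by exists 1 => x; rewrite indicE; case: (_ \in _); rewrite ?normr1 ?normr0.
Qed.

Lemma bounded_measurable_integrable (m : {measure set T -> \bar R}) u :
  m [set: T] = 1%E -> bounded_measurable u ->
  m.-integrable [set: T] (EFin \o u).
Proof.
move=> m1 [mu [M uM]]; apply: measurable_bounded_integrable => //.
  by rewrite m1 ltry.
exists M; split; first exact: num_real.
by move=> N MN x _ /=; rewrite (le_trans (uM x))// ltW.
Qed.

End bounded_measurable.

Lemma bounded_measurable_comp d d' (T : measurableType d)
    (T' : measurableType d') (R : realType) (u : T' -> R) (f : T -> T') :
  bounded_measurable u -> measurable_fun [set: T] f ->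
  bounded_measurable (fun x => u (f x)).
Proof.
move=> [mu [M uM]] mf; split; first exact: measurableT_comp mu mf.
by exists M.
Qed.

Section integral_ae.
Context d (T : measurableType d) (R : realType).
Variable m : {measure set T -> \bar R}.

Lemma ae_eq_Rintegral (u v : T -> R) :
  measurable_fun [set: T] u -> measurable_fun [set: T] v ->
  {ae m, forall x, u x = v x} -> \int[m]_x u x = \int[m]_x v x.
Proof.
move=> mu mv uv; rewrite /Rintegral; congr fine.
apply: ae_eq_integral => //; try exact/measurable_EFinP.
by apply: filterS uv => x /= ->.
Qed.

Lemma ae_eq0_of_integral0 (u : T -> R) :
  m.-integrable [set: T] (EFin \o u) -> {ae m, forall x, 0 <= u x} ->
  \int[m]_x u x = 0 -> {ae m, forall x, u x = 0}.
Proof.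
move=> iu u0 Iu0.
have mu := measurable_int _ iu.
have : (\int[m]_x `|(u x)%:E| = 0)%E.
  rewrite (ae_eq_integral (EFin \o u)) //.
  - rewrite -[LHS]fineK ?integrable_fin_num//.
    by congr EFin; rewrite -[RHS]Iu0.
  - exact: measurableT_comp.
  - by apply: filterS u0 => x /= ux _; rewrite ger0_norm.
move/(ae_eq_integral_abs m measurableT mu).1; apply: filterS => x /= h.
by have [] := h I.
Qed.

End integral_ae.

Section ergodicity.
Context d (T : measurableType d) (R : realType).
Variables (m : {measure set T -> \bar R}) (f : T -> T).

Lemma ae_measure_preserving (P : T -> Prop) : measure_preserving m f ->
  {ae m, forall x, P x} -> {ae m, forall x, P (f x)}.
Proof.
move=> [mf mfE] [N [mN N0 PN]]; exists (f @^-1` N); split.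
- by rewrite -[X in measurable X]setTI; exact: mf.
- by rewrite mfE.
- by move=> x /= nP; apply: PN.
Qed.

(* A set invariant up to null sets agrees almost everywhere with the strictly
   invariant set of points visiting it infinitely often. *)
Lemma ergodic_ae_invariant (A : set T) : ergodic m f -> measurable A ->
  {ae m, forall x, A (f x) <-> A x} -> m A = 0%E \/ m (~` A) = 0%E.
Proof.
move=> [fp fE] mA fA.
pose B := \bigcap_N \bigcup_(n in [set n | (N <= n)%N]) (iter n f @^-1` A).
have mf n : measurable_fun [set: T] (iter n f).
  elim: n => [|n IH]; first exact: measurable_id.
  exact: (measurableT_comp fp.1 IH).
have mB : measurable B.
  apply: bigcapT_measurable => N; apply: bigcup_measurable => n _.
  by rewrite -[X in measurable X]setTI; exact: mf.
have iA n : {ae m, forall x, A (iter n f x) <-> A x}.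
  elim: n => [|n IH]; first exact: aeW.
  have := ae_measure_preserving fp IH; apply: filterS2 fA => x.
  by rewrite -iterSr => <- ->.
have AB : {ae m, forall x, A x <-> B x}.
  apply: filterS (ae_foralln iA) => x xA; split.
    by move=> Ax N _; exists N => //=; exact/xA.
  by move=> /(_ 0%N I)[n _ /xA].
have mE C D : measurable C -> measurable D ->
    {ae m, forall x, C x <-> D x} -> m C = 0%E -> m D = 0%E.
  move=> mC mD [N [mN N0 CDN]] C0; apply/(negligibleP _ mD).
  apply: (@negligibleS _ _ _ _ (C `|` N)).
    move=> x Dx; have [Cx|nCx] := pselect (C x); [by left|right].
    by apply: CDN => /= -[_ /(_ Dx)].
  by apply: negligibleU; exact/negligibleP.
have fB : f @^-1` B = B.
  apply/seteqP; split => x /= xB N _.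
    have [n Nn Afx] := xB N I; exists n.+1; first exact: leqW.
    by rewrite /preimage /mkset iterSr.
  have [[|n] // Nn Afx] := xB N.+1 I.
  by exists n => //; rewrite /preimage /mkset -iterSr.
have BA : {ae m, forall x, B x <-> A x} by apply: filterS AB => x ->.
have [B0|B0] := fE B mB fB; [left|right].
  exact: mE BA B0.
apply: mE B0; [exact: measurableC..|].
by apply: filterS BA => x BAx; split => h /BAx.
Qed.

(** A single level set is enough, that of the mean [a]: as [a < H] holds almost nowhere or almost
    everywhere, one of [a - H] and [H - a] is almost everywhere non-negative with integral 0. *)
Lemma ergodic_integrable_cst (H : T -> R) : ergodic m f -> m [set: T] = 1%E ->
  m.-integrable [set: T] (EFin \o H) ->
  {ae m, forall x, H (f x) = H x} -> exists a, {ae m, forall x, H x = a}.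
Proof.
move=> fE m1 iH Hf; pose a := \int[m]_x H x; exists a.
have ic : m.-integrable [set: T] (EFin \o (fun=> a)).
  by apply: bounded_measurable_integrable => //; exact: bounded_measurable_cst.
have Ic : \int[m]_x (fun=> a) x = a.
  by rewrite Rintegral_cst// m1 /= mulr1.
have mH : measurable_fun [set: T] H by apply/measurable_EFinP; exact: measurable_int iH.
pose A := [set x | a < H x].
have mA : measurable A.
  by rewrite -[A]setTI; exact: measurable_fun_ltr.
have fA : {ae m, forall x, A (f x) <-> A x}.
  by apply: filterS Hf => x; rewrite /A /= => ->.
case: (ergodic_ae_invariant fE mA fA) => A0.
- have : {ae m, forall x, 0 <= a - H x}.
    exists A; split => // x /=; rewrite subr_ge0 => /negP; rewrite -ltNge.
    exact.
  move=> /(ae_eq0_of_integral0 (integrableB measurableT ic iH)).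
  rewrite RintegralB// Ic subrr => /(_ erefl); apply: filterS => x /eqP.
  by rewrite subr_eq0 => /eqP.
- have : {ae m, forall x, 0 <= H x - a}.
    exists (~` A); split => //; first exact: measurableC.
    move=> x /=; rewrite subr_ge0 /A /= => h /ltW; exact: h.
  move=> /(ae_eq0_of_integral0 (integrableB measurableT iH ic)).
  rewrite RintegralB// Ic subrr => /(_ erefl); apply: filterS => x /eqP.
  by rewrite subr_eq0 => /eqP.
Qed.

End ergodicity.

(** * Products of probability measures *)

Section product_ae.
Context dX (X : measurableType dX) dY (Y : measurableType dY) (R : realType).
Variables (mu : probability X R) (nu : probability Y R).
Local Notation mn := (mu \x nu)%E.

Lemma product_measure1_setT : mn [set: X * Y] = 1%E.
Proof.
rewrite -setXTT; transitivity (mu setT * nu setT)%E.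
  exact: product_measure1E.
by rewrite !probability_setT mule1.
Qed.

Lemma ae_xsection (P : X * Y -> Prop) : {ae mn, forall p, P p} ->
  {ae mu, forall x, {ae nu, forall y, P (x, y)}}.
Proof.
move=> [N [mN N0 PN]].
have mf := measurable_fun_xsection nu mN.
have : (\int[mu]_x `|nu (xsection N x)| = 0)%E.
  by rewrite -[RHS]N0; apply: eq_integral => x _; rewrite gee0_abs.
move/(ae_eq_integral_abs mu measurableT mf).1; apply: filterS => x /(_ I) /= Nx.
exists (xsection N x); split => //; first exact: measurable_xsection.
by move=> y /= nP; rewrite xsectionE; exact: PN.
Qed.

Lemma ae_ysection (P : X * Y -> Prop) : {ae mn, forall p, P p} ->
  {ae nu, forall y, {ae mu, forall x, P (x, y)}}.
Proof.
move=> [N [mN N0 PN]].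
have mf := measurable_fun_ysection mu mN.
have : (\int[nu]_y `|mu (ysection N y)| = 0)%E.
  (* The measure [mu \x nu] is defined by integrating x-sections; uniqueness of the product measure
     gives access to the y-sections. *)
  rewrite -[RHS]N0 (product_measure_unique (m' := (mu \x^ nu)%E))//.
    by apply: eq_integral => x _; rewrite gee0_abs.
  by move=> A B mA mB; rewrite /= product_measure2E.
move/(ae_eq_integral_abs nu measurableT mf).1; apply: filterS => y /(_ I) /= Ny.
exists (ysection N y); split => //; first exact: measurable_ysection.
by move=> x /= nP; rewrite ysectionE; exact: PN.
Qed.

(** The bridge from the action to the skew product: a statement about [S (phi x)] is proved for each
    fixed x, with a null set of y depending on x. Measurability of the set is what allows its
    measure to be computed from its sections. *)
Lemma ae_of_xsection (P : X * Y -> Prop) : measurable [set p | P p] ->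
  (forall x, {ae nu, forall y, P (x, y)}) -> {ae mn, forall p, P p}.
Proof.
move=> mP aP; apply/negligibleP; first exact: measurableC.
rewrite /product_measure1 -[RHS](integral0 mu setT); apply: eq_integral => x _.
apply: (measure_negligible _ _).
  by apply: measurable_xsection; exact: measurableC.
by move: (aP x); apply: negligibleS => y; rewrite xsectionE.
Qed.

Lemma ae_fst (P : X -> Prop) : {ae mu, forall x, P x} -> {ae mn, forall p, P p.1}.
Proof.
move=> [N [mN N0 PN]]; exists (N `*` setT); split.
- exact: measurableX.
- transitivity (mu N * nu setT)%E; first exact: product_measure1E.
  by rewrite N0 mul0e.
- by move=> p nP; split => //; exact: PN.
Qed.

Lemma ae_snd (P : Y -> Prop) : {ae nu, forall y, P y} -> {ae mn, forall p, P p.2}.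
Proof.
move=> [N [mN N0 PN]]; exists (setT `*` N); split.
- exact: measurableX.
- transitivity (mu setT * nu N)%E; first exact: product_measure1E.
  by rewrite N0 mule0.
- by move=> p nP; split => //; exact: PN.
Qed.

Lemma ae_of_fst (P : X -> Prop) : {ae mn, forall p, P p.1} -> {ae mu, forall x, P x}.
Proof.
move=> /ae_xsection; apply: filterS => x /= nP.
have : (0 < nu [set: Y])%E by rewrite probability_setT.
move=> /ae_properfilter_algebraOfSetsType PF.
by have [y] := @filter_ex _ _ PF _ nP.
Qed.

Lemma ae_of_snd (P : Y -> Prop) : {ae mn, forall p, P p.2} -> {ae nu, forall y, P y}.
Proof.
move=> /ae_ysection; apply: filterS => y /= nP.
have : (0 < mu [set: X])%E by rewrite probability_setT.
move=> /ae_properfilter_algebraOfSetsType PF.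
by have [x] := @filter_ex _ _ PF _ nP.
Qed.

Lemma Fubini_Rintegral (H : X * Y -> R) : bounded_measurable H ->
  [/\ bounded_measurable (fun y => \int[mu]_x H (x, y)),
      bounded_measurable (fun x => \int[nu]_y H (x, y)),
      \int[nu]_y \int[mu]_x H (x, y) = \int[mn]_p H p &
      \int[mu]_x \int[nu]_y H (x, y) = \int[mn]_p H p].
Proof.
move=> bH.
have bHx x : bounded_measurable (fun y => H (x, y)).
  by apply: bounded_measurable_comp bH _; exact: pair1_measurable.
have bHy y : bounded_measurable (fun x => H (x, y)).
  by apply: bounded_measurable_comp bH _; exact: pair2_measurable.
have ix x := bounded_measurable_integrable (probability_setT nu) (bHx x).
have iy y := bounded_measurable_integrable (probability_setT mu) (bHy y).
have iH := bounded_measurable_integrable product_measure1_setT bH.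
have Ex x : (\int[nu]_y (H (x, y))%:E = (\int[nu]_y H (x, y))%:E)%E.
  by rewrite fineK//; exact: (integrable_fin_num measurableT (ix x)).
have Ey y : (\int[mu]_x (H (x, y))%:E = (\int[mu]_x H (x, y))%:E)%E.
  by rewrite fineK//; exact: (integrable_fin_num measurableT (iy y)).
have mF := measurable_fubini_F iH.
have mG := measurable_fubini_G iH.
have [M MH] := bH.2.
have bound dT (T : measurableType dT) (m : probability T R) (u : T -> R) :
    bounded_measurable u -> (forall t, `|u t| <= M) -> `|\int[m]_t u t| <= M.
  move=> bu uM.
  have iu := bounded_measurable_integrable (probability_setT m) bu.
  apply: (le_trans (le_normr_Rintegral measurableT iu)).
  have -> : M = \int[m]_t cst M t.
    by rewrite Rintegral_cst// [X in fine X](probability_setT m) mulr1.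
  apply: le_Rintegral => //; first exact: integrable_norm.
  apply: bounded_measurable_integrable; first exact: probability_setT.
  exact: bounded_measurable_cst.
split.
- split; last by exists M => y; apply: bound => // x; exact: MH.
  apply/measurable_EFinP; apply: eq_measurable_fun mG => y _.
  by rewrite /fubini_G Ey.
- split; last by exists M => x; apply: bound => // y; exact: MH.
  apply/measurable_EFinP; apply: eq_measurable_fun mF => x _.
  by rewrite /fubini_F Ex.
- rewrite {1 3}/Rintegral -integral21_prod_meas1//; congr fine.
  by apply: eq_integral => y _; rewrite /fubini_G Ey.
- rewrite {1 3}/Rintegral -integral12_prod_meas1//; congr fine.
  by apply: eq_integral => x _; rewrite /fubini_F Ex.
Qed.

(** Integrating the hypothesis over a measurable set of y shows that [H] has integral 0 on every
    rectangle. The pi-lambda theorem extends this to all measurable sets, which forces [H] to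
    vanish. *)
Lemma ae_eq0_of_partial_integrals (H : X * Y -> R) : bounded_measurable H ->
  (forall A, measurable A -> {ae nu, forall y, \int[mu]_x (\1_A x * H (x, y)) = 0}) ->
  {ae mn, forall p, H p = 0}.
Proof.
move=> bH H0.
have iH := bounded_measurable_integrable product_measure1_setT bH.
have iS S : measurable S -> mn.-integrable S (EFin \o H).
  by move=> mS; apply: integrableS iH.
suff S0 S : measurable S -> (\int[mn]_(p in S) (H p)%:E = 0)%E.
  have : ae_eq mn setT (EFin \o H) (cst 0%E).
    apply: integral_ae_eq => // S _ mS.
    by rewrite S0// integral0.
  by apply: filterS => p /= /(_ I) [].
pose P S := (\int[mn]_(p in S) (H p)%:E = 0)%E.
have rect A B : measurable A -> measurable B -> P (A `*` B).
  move=> mA mB; rewrite /P integral_mkcond.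
  have bAB : bounded_measurable (fun p => \1_B p.2 * (\1_A p.1 * H p)).
    apply: bounded_measurableM; last apply: bounded_measurableM => //.
      by apply: bounded_measurable_comp measurable_snd; exact: bounded_measurable_indic.
    by apply: bounded_measurable_comp measurable_fst; exact: bounded_measurable_indic.
  have [_ _ + _] := Fubini_Rintegral bAB.
  rewrite (ae_eq_Rintegral (v := cst 0)) /=; last 3 first.
  - by have [[]] := Fubini_Rintegral bAB.
  - exact: measurable_cst.
  - move: (H0 A mA); apply: filterS => y I0.
    have bA : bounded_measurable (fun x => \1_A x * H (x, y)).
      apply: bounded_measurableM; first exact: bounded_measurable_indic.
      by apply: bounded_measurable_comp bH _; exact: pair2_measurable.
    have iA := bounded_measurable_integrable (probability_setT mu) bA.
    transitivity (\1_B y * \int[mu]_x (\1_A x * H (x, y))).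
      exact: (RintegralZl _ measurableT iA).
    by rewrite I0 mulr0.
  rewrite Rintegral_cst// mul0r => /esym I0.
  have iAB := bounded_measurable_integrable product_measure1_setT bAB.
  rewrite -[RHS]/(0%:E) -I0 fineK ?integrable_fin_num//.
  apply: eq_integral => -[x y] _; rewrite /patch !indicE /= in_setX.
  by case: (x \in A); case: (y \in B); rewrite /= ?mul1r ?mul0r.
rewrite measurable_prod_measurableType.
move=> mS; apply: (dynkin_induction (P := P)
  (measurable_prod_measurableType X Y) _ _ _ _ _ mS).
- move=> _ _ [A mA [B mB <-]] [C mC [D mD <-]]; exists (A `&` C).
    exact: measurableI.
  by exists (B `&` D); [exact: measurableI|rewrite setXI].
- by rewrite -setXTT; exact: rect.
- by move=> _ [A mA [B mB <-]]; exact: rect.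
- move=> U mU PU; have : P setT by rewrite -setXTT; exact: rect.
  rewrite /P -(setUv U) integral_setU//.
  + by rewrite [X in (X + _)%E]PU add0e.
  + exact: measurableC.
  + by rewrite setUv; exact: measurable_int iH.
  + by apply/disj_setPCl.
- move=> F mF tF PF; rewrite /P integral_bigcup//; last first.
    by apply: iS; exact: bigcupT_measurable.
  by rewrite eseries0// => i _ _; exact: PF.
Qed.

End product_ae.

(** * Complex-valued functions *)

Lemma Re_norm_lt {R : realType} (z e : R[i]) :
  complex.Re `|z| < complex.Re e -> 
  `|complex.Re z| < complex.Re e /\ `|complex.Im z| < complex.Re e.
Proof.
rewrite normc_def /= => h; split; apply: le_lt_trans h;
  by rewrite -sqrtr_sqr ler_sqrt ?addr_ge0 ?sqr_ge0// (lerDl, lerDr) sqr_ge0.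
Qed.

Lemma open_Re_gt {R : realType} (a : R) :
  open ([set z | a < complex.Re z] : set R[i]^o).
Proof.
rewrite openE => z /= az; apply/nbhs_ballP.
exists ((complex.Re z - a)%:C)%C; first by rewrite /= ltcR subr_gt0.
move=> w; rewrite /ball /= => /(@lt_le_trans _ _ _ _ _)/(_ (lexx _)).
case: z az => x y; case: w => x' y' /= az.
rewrite ltcE /= => /andP[_];
  have := @Re_norm_lt _ (Complex (x - x') (y - y')) (Complex (x - a) 0).
by rewrite normc_def /= => h /h[+ _]; rewrite ltr_norml => /andP[]; lra.
Qed.

Lemma open_Im_gt {R : realType} (a : R) :
  open ([set z | a < complex.Im z] : set R[i]^o).
Proof.
rewrite openE => z /= az; apply/nbhs_ballP.
exists ((complex.Im z - a)%:C)%C; first by rewrite /= ltcR subr_gt0.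
move=> w; rewrite /ball /= => /(@lt_le_trans _ _ _ _ _)/(_ (lexx _)).
case: z az => x y; case: w => x' y' /= az.
rewrite ltcE /= => /andP[_];
  have := @Re_norm_lt _ (Complex (x - x') (y - y')) (Complex (y - a) 0).
by rewrite normc_def /= => h /h[_ +]; rewrite ltr_norml => /andP[]; lra.
Qed.

(** * Borel measurability through real and imaginary parts *)

Section measurable_complex.
Context d (T : measurableType d) (R : realType).
Implicit Types F : T -> R[i].

Lemma measurable_Re F : measurable_fun [set: T] (F : T -> borelC R) ->
  measurable_fun [set: T] (fun x => complex.Re (F x)).
Proof.
move=> mF; apply: (measurability _ (RGenOInfty.measurableE R)).
move=> _ [_ [a ->] <-].
rewrite (_ : _ @^-1` _ = F @^-1` [set z | a < complex.Re z]); last first.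
  by apply/seteqP; split => x /=; rewrite in_itv /= andbT.
by apply: mF => //; apply: sub_sigma_algebra; exact: open_Re_gt.
Qed.

Lemma measurable_Im F : measurable_fun [set: T] (F : T -> borelC R) ->
  measurable_fun [set: T] (fun x => complex.Im (F x)).
Proof.
move=> mF; apply: (measurability _ (RGenOInfty.measurableE R)).
move=> _ [_ [a ->] <-].
rewrite (_ : _ @^-1` _ = F @^-1` [set z | a < complex.Im z]); last first.
  by apply/seteqP; split => x /=; rewrite in_itv /= andbT.
by apply: mF => //; apply: sub_sigma_algebra; exact: open_Im_gt.
Qed.

Lemma measurable_complex F :
  measurable_fun [set: T] (fun x => complex.Re (F x)) ->
  measurable_fun [set: T] (fun x => complex.Im (F x)) ->
  measurable_fun [set: T] (F : T -> borelC R).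
Proof.
move=> mRe mIm; apply: (@measurability _ _ T (borelC R) setT F open) => //.
move=> _ [U oU <-]; rewrite setTI.
pose box (q : rat * rat * rat) : set R[i] := [set z |
  `|complex.Re z - ratr q.1.1| < ratr q.2 /\ `|complex.Im z - ratr q.1.2| < ratr q.2].
(* The preimage of [U] is the union of the preimages of the rational boxes inside [U]; indices
   coding no such box contribute the empty set. *)
pose B n : set T := if unpickle n is Some q then
  if `[< box q `<=` U >] then F @^-1` box q else set0 else set0.
have mB n : measurable (B n).
  rewrite /B; case: unpickle => [q|//]; case: asbool => //.
  rewrite (_ : F @^-1` _ =
    (setT `&` (fun x => complex.Re (F x)) @^-1` ball (ratr q.1.1 : R) (ratr q.2)) `&`
    (setT `&` (fun x => complex.Im (F x)) @^-1` ball (ratr q.1.2 : R) (ratr q.2))).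
    by apply: measurableI; [apply: mRe|apply: mIm] => //; exact: measurable_ball.
  by rewrite !setTI; apply/seteqP; split => x [] /=; rewrite /box /ball /= => h1 h2;
    split; rewrite // distrC.
rewrite (_ : F @^-1` U = \bigcup_n B n); first exact: bigcupT_measurable.
apply/seteqP; split => x /=; last first.
  move=> [n _]; rewrite /B; case: unpickle => [q|//].
  by case: asboolP => // qU Fx; exact: qU.
move=> UFx; move: oU; rewrite openE => /(_ _ UFx)/nbhs_ballP[e /= e0 eU].
have e0' : 0 < complex.Re e by case: e e0 {eU} => a b; rewrite ltcE => /andP[].
have near_rat (a b : R) : a < b -> exists q : rat, a < ratr q < b.
  by move=> /rat_in_itvoo[q]; rewrite in_itv; exists q.
(* A box of half-side [r] has sides [2 * r], so any two of its points are within [4 * r] of each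
   other, which is less than the radius of the ball inside [U]. *)
have [r /andP[r0 re]] := near_rat 0 (complex.Re e / 4) ltac:(lra).
have [q1 /andP[q1l q1r]] :=
  near_rat (complex.Re (F x) - ratr r) (complex.Re (F x)) ltac:(lra).
have [q2 /andP[q2l q2r]] :=
  near_rat (complex.Im (F x) - ratr r) (complex.Im (F x)) ltac:(lra).
exists (pickle (q1, q2, r)); first exact: I.
rewrite /B pickleK.
case: asboolP => [_|[]].
  by split => /=; rewrite ltr_norml; apply/andP; split; lra.
move=> w [/= w1 w2]; apply: eU; rewrite /ball /=; apply: normC_lt => //.
apply: le_lt_trans (normC_le_Re_Im _) _.
have -> : complex.Re (F x - w) = complex.Re (F x) - complex.Re w by rewrite raddfB.
have -> : complex.Im (F x - w) = complex.Im (F x) - complex.Im w by rewrite raddfB.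
move: w1 w2; rewrite !ltr_norml => /andP[w1 w1'] /andP[w2 w2'].
apply: (@lt_le_trans _ _ (complex.Re e / 2 + complex.Re e / 2)); last by lra.
by apply: ltrD; rewrite ltr_norml; apply/andP; split; lra.
Qed.

End measurable_complex.

Lemma cis2pi_surj {R : realType} (c : R[i]) : `|c| = 1 ->
  exists2 t : R, 0 <= t < 1 & c = cis2pi t.
Proof.
case: c => a b; rewrite normc_def /= => -[ab1].
have {ab1} ab : a ^+ 2 + b ^+ 2 = 1.
  by rewrite -[LHS]sqr_sqrtr ?addr_ge0 ?sqr_ge0// ab1 expr1n.
have a1 : -1 <= a <= 1.
  by rewrite -ler_norml -sqrtr_sqr -(sqrtr1 R) ler_sqrt// -ab lerDl sqr_ge0.
have aI : a \in `[-1, 1] by rewrite in_itv.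
have pi0 := pi_gt0 R.
have sE : sin (acos a) ^+ 2 = b ^+ 2 by rewrite sin2cos2 acosK// -ab addrC addKr.
have s0 : 0 <= sin (acos a) by rewrite sin_ge0_pi// acos_ge0// acos_lepi.
have sb : sin (acos a) = `|b|.
  by apply/eqP; rewrite -(@eqrXn2 _ 2)// ?real_normK ?num_real//; exact/eqP.
have l0 := acos_ge0 a1; have lp := acos_lepi a1.
have [b0|b0] := leP 0 b.
  exists (acos a / (2 * pi)).
    apply/andP; split; first by rewrite divr_ge0// mulr_ge0// ltW.
    by rewrite ltr_pdivrMr ?mul1r ?mulr_gt0//; lra.
  rewrite /cis2pi mulrCA divff ?mulr1 ?acosK// ?sb ?ger0_norm//.
  by rewrite mulf_neq0// gt_eqF.
(* Here [b < 0] excludes [a = 1], so [acos a] is not 0; this keeps the angle [2 * pi - acos a]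
   strictly below a full turn, whence [t < 1]. *)
have al0 : 0 < acos a.
  rewrite acos_gt0//; case/andP: a1 => -> a1 /=; rewrite lt_neqAle a1 andbT.
  apply/eqP => aE; move: ab; rewrite aE expr1n => /eqP.
  by rewrite -subr_eq0 addrAC subrr add0r sqrf_eq0 lt_eqF.
exists ((2 * pi - acos a) / (2 * pi)).
  apply/andP; split; first by rewrite divr_ge0//; lra.
  by rewrite ltr_pdivrMr ?mul1r ?mulr_gt0//; lra.
rewrite /cis2pi mulrCA divff ?mulr1; last by rewrite mulf_neq0// gt_eqF.
rewrite mulr_natl addrC cosD2pi sinD2pi cosN sinN acosK// sb ltr0_norm//.
by rewrite opprK.
Qed.

Lemma norm_cis2pi {R : realType} (t : R) : `|cis2pi t| = 1.
Proof. by rewrite normc_def /= cos2Dsin2 sqrtr1. Qed.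

Lemma ReM {R : realType} (z w : R[i]) : complex.Re (z * w) =
  complex.Re z * complex.Re w - complex.Im z * complex.Im w.
Proof. by case: z w => [a b] [a' b']. Qed.

Lemma ImM {R : realType} (z w : R[i]) : complex.Im (z * w) =
  complex.Re z * complex.Im w + complex.Im z * complex.Re w.
Proof. by case: z w => [a b] [a' b']. Qed.

Lemma Re_conj {R : realType} (z : R[i]) : complex.Re z^* = complex.Re z.
Proof. by case: z. Qed.

Lemma Im_conj {R : realType} (z : R[i]) : complex.Im z^* = - complex.Im z.
Proof. by case: z. Qed.

Lemma complex_eq {R : realType} (z w : R[i]) :
  complex.Re z = complex.Re w -> complex.Im z = complex.Im w -> z = w.
Proof. by case: z w => [a b] [a' b'] /= -> ->. Qed.

(** Removes the square root: a test on the norm becomes a polynomial equation in the real and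
    imaginary parts, visibly measurable. *)
Lemma norm_complex_sqr {R : realType} (z : R[i]) (s : R) : 0 <= s ->
  (`|z| == s%:C%C) = (complex.Re z ^+ 2 + complex.Im z ^+ 2 == s ^+ 2).
Proof.
move=> s0; rewrite -(@eqrXn2 _ 2%N)// ?lecR// -add_Re2_Im2 -rmorphXn /=.
by apply/eqP/eqP => [[]//|->].
Qed.

Section measurable_bounded_complex.
Context d (T : measurableType d) (R : realType).
Implicit Types F H : T -> R[i].

Definition bounded_measurableC F : Prop :=
  bounded_measurable (fun x => complex.Re (F x)) /\
  bounded_measurable (fun x => complex.Im (F x)).

Lemma bounded_measurableC_cst c : bounded_measurableC (fun=> c).
Proof. by split; exact: bounded_measurable_cst. Qed.

Lemma bounded_measurableC_conj F :
  bounded_measurableC F -> bounded_measurableC (fun x => (F x)^*).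
Proof.
move=> [bR bI]; split.
  by under [X in bounded_measurable X]eq_fun do rewrite Re_conj.
under [X in bounded_measurable X]eq_fun do rewrite Im_conj -mulN1r.
by apply: bounded_measurableM => //; exact: bounded_measurable_cst.
Qed.

Lemma bounded_measurableCM F H : bounded_measurableC F -> bounded_measurableC H ->
  bounded_measurableC (fun x => F x * H x).
Proof.
move=> [FR FI] [HR HI]; split.
  under [X in bounded_measurable X]eq_fun do rewrite ReM.
  by apply: bounded_measurableB; exact: bounded_measurableM.
under [X in bounded_measurable X]eq_fun do rewrite ImM.
by apply: bounded_measurableD; exact: bounded_measurableM.
Qed.

Lemma bounded_measurableC_norm1 F : (forall x, `|F x| = 1) ->
  measurable_fun [set: T] (fun x => complex.Re (F x)) ->
  measurable_fun [set: T] (fun x => complex.Im (F x)) -> bounded_measurableC F.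
Proof.
move=> F1 mR mI.
have le1 (a b : R) : a ^+ 2 + b ^+ 2 = 1 -> `|a| <= 1.
  move=> ab; rewrite -(@expr_le1 _ 2%N)// real_normK ?num_real// -ab.
  by rewrite lerDl sqr_ge0.
have b1 x : `|complex.Re (F x)| <= 1 /\ `|complex.Im (F x)| <= 1.
  have /eqP := F1 x; rewrite -[1 in X in X -> _]/(1%:C)%C norm_complex_sqr// => /eqP.
  by rewrite expr1n => E; split; [|rewrite addrC in E]; exact: le1 E.
by split; split => //; exists 1 => x; case: (b1 x).
Qed.

Lemma measurable_of_bounded_measurableC F :
  bounded_measurableC F -> measurable_fun [set: T] (F : T -> borelC R).
Proof. by move=> [[mR _] [mI _]]; exact: measurable_complex. Qed.

(** Supplies the measurability premise of [ae_of_xsection] for equations between complex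
    functions. *)
Lemma measurable_eqC F H :
  measurable_fun [set: T] (F : T -> borelC R) ->
  measurable_fun [set: T] (H : T -> borelC R) -> measurable [set x | F x = H x].
Proof.
move=> mF mH; rewrite (_ : [set x | _] =
    (setT `&` [set x | complex.Re (F x) == complex.Re (H x)]) `&`
    (setT `&` [set x | complex.Im (F x) == complex.Im (H x)])).
  apply: measurableI.
    by apply: measurable_fun_eqr => //; exact: measurable_Re.
  by apply: measurable_fun_eqr => //; exact: measurable_Im.
rewrite !setTI; apply/seteqP; split => x /= => [->//|[/eqP ? /eqP ?]].
exact: complex_eq.
Qed.

Lemma measurable_funCM F H :
  measurable_fun [set: T] (F : T -> borelC R) ->
  measurable_fun [set: T] (H : T -> borelC R) ->
  measurable_fun [set: T] ((fun x => F x * H x) : T -> borelC R).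
Proof.
move=> mF mH; have [mFR mFI] := (measurable_Re mF, measurable_Im mF).
have [mHR mHI] := (measurable_Re mH, measurable_Im mH).
apply: measurable_complex.
  under [X in measurable_fun _ X]eq_fun do rewrite ReM.
  by apply: measurable_funB; exact: measurable_funM.
under [X in measurable_fun _ X]eq_fun do rewrite ImM.
by apply: measurable_funD; exact: measurable_funM.
Qed.

(* The value 1 off the sphere of radius [s] makes the result unimodular
   everywhere, not just almost everywhere. *)
Definition unimodular_part (s : R) F (x : T) : R[i] :=
  if `|F x| == (s%:C)%C then F x / (s%:C)%C else 1.

Lemma unimodular_part_norm s F x : 0 < s -> `|unimodular_part s F x| = 1.
Proof.
move=> s0; rewrite /unimodular_part; case: eqP => [Fs|_]; last exact: normr1.
have s0' : (s%:C)%C != 0 :> R[i] by rewrite fmorph_eq0 gt_eqF.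
by rewrite normrM normfV Fs ger0_norm ?divff// lecR ltW.
Qed.

Lemma unimodular_partE s F x : 0 < s -> `|F x| = (s%:C)%C ->
  F x = (s%:C)%C * unimodular_part s F x.
Proof.
move=> s0 Fs; rewrite /unimodular_part Fs eqxx mulrC divfK//.
by rewrite fmorph_eq0 gt_eqF.
Qed.

Lemma bounded_measurableC_unimodular_part s F : 0 < s ->
  measurable_fun [set: T] (F : T -> borelC R) ->
  bounded_measurableC (unimodular_part s F).
Proof.
move=> s0 mF; have [mR mI] := (measurable_Re mF, measurable_Im mF).
have ms : measurable_fun [set: T]
    (fun x => complex.Re (F x) ^+ 2 + complex.Im (F x) ^+ 2 == s ^+ 2).
  apply: measurable_fun_eqr; last exact: measurable_cst.
  by apply: measurable_funD; exact: measurable_funX.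
have E (z : R[i]) : z / (s%:C)%C = z * (s^-1%:C)%C by rewrite fmorphV.
apply: bounded_measurableC_norm1; first by move=> x; exact: unimodular_part_norm.
  apply: (eq_measurable_fun (fun x =>
      if complex.Re (F x) ^+ 2 + complex.Im (F x) ^+ 2 == s ^+ 2
      then complex.Re (F x) * s^-1 else 1)).
    move=> x _; rewrite /unimodular_part norm_complex_sqr ?ltW//.
    by case: ifP => // _; rewrite E ReM /= mulr0 subr0.
  apply: measurable_fun_ifT => //.
  by apply: measurable_funM => //; exact: measurable_cst.
apply: (eq_measurable_fun (fun x =>
    if complex.Re (F x) ^+ 2 + complex.Im (F x) ^+ 2 == s ^+ 2
    then complex.Im (F x) * s^-1 else 0)).
  move=> x _; rewrite /unimodular_part norm_complex_sqr ?ltW//.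
  by case: ifP => // _; rewrite E ImM /= mulr0 add0r.
apply: measurable_fun_ifT => //.
by apply: measurable_funM => //; exact: measurable_cst.
Qed.

End measurable_bounded_complex.

Lemma bounded_measurableC_comp d d' (T : measurableType d)
    (T' : measurableType d') (R : realType) (F : T' -> R[i]) (f : T -> T') :
  bounded_measurableC F -> measurable_fun [set: T] f ->
  bounded_measurableC (fun x => F (f x)).
Proof.
by move=> [bR bI] mf; split; [exact: bounded_measurable_comp bR mf|
  exact: bounded_measurable_comp bI mf].
Qed.

Section complex_integral.
Context d (T : measurableType d) (R : realType).
Variable m : {measure set T -> \bar R}.
Implicit Types F H : T -> R[i].

Definition Cintegral F : R[i] :=
  Complex (\int[m]_x complex.Re (F x)) (\int[m]_x complex.Im (F x)).

Lemma ae_eq_Cintegral F H : bounded_measurableC F -> bounded_measurableC H ->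
  {ae m, forall x, F x = H x} -> Cintegral F = Cintegral H.
Proof.
move=> [[FR _] [FI _]] [[HR _] [HI _]] FH.
by rewrite /Cintegral; congr Complex; apply: ae_eq_Rintegral => //;
  apply: filterS FH => x ->.
Qed.

Lemma CintegralZl z F : m [set: T] = 1%E -> bounded_measurableC F ->
  Cintegral (fun x => z * F x) = z * Cintegral F.
Proof.
move=> m1 [bR bI].
have Z a u : bounded_measurable u -> \int[m]_x (a * u x) = a * \int[m]_x u x.
  move=> bu; have iu := bounded_measurable_integrable m1 bu.
  exact: (RintegralZl _ measurableT iu).
have bZ (a : R) (u : T -> R) :
    bounded_measurable u -> bounded_measurable (fun x => a * u x).
  by move=> bu; apply: bounded_measurableM => //; exact: bounded_measurable_cst.
have iZ (a : R) (u : T -> R) (bu : bounded_measurable u) :=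
  bounded_measurable_integrable m1 (bZ a u bu).
apply: complex_eq; rewrite ?ReM ?ImM /Cintegral /=.
  under eq_Rintegral do rewrite ReM.
  by rewrite (RintegralB measurableT (iZ _ _ bR) (iZ _ _ bI)) !Z.
under eq_Rintegral do rewrite ImM.
by rewrite (RintegralD measurableT (iZ _ _ bI) (iZ _ _ bR)) !Z.
Qed.

Lemma ergodic_bounded_cst (f : T -> T) F : ergodic m f -> m [set: T] = 1%E ->
  bounded_measurableC F -> {ae m, forall x, F (f x) = F x} ->
  exists c, {ae m, forall x, F x = c}.
Proof.
move=> fE m1 [bR bI] Ff.
have [|a Ra] := ergodic_integrable_cst fE m1 (bounded_measurable_integrable m1 bR).
  by apply: filterS Ff => x ->.
have [|b Ib] := ergodic_integrable_cst fE m1 (bounded_measurable_integrable m1 bI).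
  by apply: filterS Ff => x ->.
exists (Complex a b); apply: filterS2 Ra Ib => x xa xb.
exact: complex_eq.
Qed.

End complex_integral.

(** * Eigenfunctions of skew products *)

(** The pi-lambda theorem again; the common total mass 1 settles complements, through
    [1 - l z U]. *)
Lemma measurable_measure_of_rect dZ (Z : measurableType dZ)
    dX (X : measurableType dX) dY (Y : measurableType dY) (R : realType)
    (l : Z -> {measure set (X * Y) -> \bar R}) :
  (forall z, l z [set: X * Y] = 1%E) ->
  (forall A B, measurable A -> measurable B ->
    measurable_fun [set: Z] (fun z => l z (A `*` B))) ->
  forall E, measurable E -> measurable_fun [set: Z] (fun z => l z E).
Proof.
move=> l1 lrect E; rewrite measurable_prod_measurableType.
apply: (dynkin_induction
  (P := fun E => measurable_fun [set: Z] (fun z => l z E))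
  (measurable_prod_measurableType X Y)).
- move=> _ _ [A mA [B mB <-]] [C mC [D mD <-]]; exists (A `&` C).
    exact: measurableI.
  by exists (B `&` D); [exact: measurableI|rewrite setXI].
- by rewrite -setXTT; exact: lrect.
- by move=> _ [A mA [B mB <-]]; exact: lrect.
- move=> U mU lU.
  apply: (eq_measurable_fun (fun z => 1 - l z U)%E); last first.
    exact: emeasurable_funB.
  move=> z _; rewrite -(l1 z) -(setUv U) measureU ?setICr//; last exact: measurableC.
  rewrite [X in (X - _)%E]addeC addeK// ge0_fin_numE// (le_lt_trans _ (ltry 1))// -(l1 z).
  by apply: le_measure; rewrite ?inE.
- move=> F mF tF lF.
  apply: (eq_measurable_fun (fun z => \sum_(0 <= n <oo) l z (F n))%E); last first.
    exact: ge0_emeasurable_sum.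
  by move=> z _; rewrite measure_bigcup//; apply: eq_eseriesl => n; rewrite in_setT.
Qed.

Section correlation.
Context dY (Y : measurableType dY) (R : realType) (G : topologicalZmodType).
Variables (nu : probability Y R) (S : G -> Y -> Y).

(* The measurability hypothesis on the action concerns the rectangles of the
   joint law of [(S g y, y)]; it extends to all bounded kernels. *)
Lemma measurable_correlation (u v : Y -> R) : measurable_action nu S ->
  bounded_measurable u -> bounded_measurable v ->
  measurable_fun [set: borel G]
    ((fun g => \int[nu]_y (u (S g y) * v y)) : borel G -> R).
Proof.
move=> [aS _ mS] bu bv.
have mSg g : measurable_fun [set: Y] (S g) by case: (aS g) => -[].
have mj g : measurable_fun [set: Y] (fun y => (S g y, y)).
  by apply: measurable_fun_pair => //; exact: measurable_id.
pose l (g : borel G) : {measure set (Y * Y) -> \bar R} :=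
  measure_function_pushforward__canonical__measure_function_Measure nu (mj g).
have bw : bounded_measurable (fun p : Y * Y => u p.1 * v p.2).
  by apply: bounded_measurableM;
    [apply: bounded_measurable_comp measurable_fst
    |apply: bounded_measurable_comp measurable_snd].
have [M wM] := bw.2.
have bwg g : bounded_measurable (fun y => u (S g y) * v y).
  exact: (bounded_measurable_comp bw (mj g)).
have iwg g := bounded_measurable_integrable (probability_setT nu) (bwg g).
(* Adding the bound [M] makes the integrand non-negative, as integration against a kernel requires;
   since [nu] has mass 1, exactly [M] is subtracted afterwards. *)
have w0 (p : Y * Y) : (0 <= (u p.1 * v p.2 + M)%:E)%E.
  rewrite lee_fin -lerBlDr sub0r lerNl.
  by have := wM p; rewrite ler_norml => /andP[]; lra.
have mw : measurable_fun [set: Y * Y] (fun p : Y * Y => (u p.1 * v p.2 + M)%:E).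
  by apply/measurable_EFinP; apply: measurable_funD => //; exact: bw.1.
have ml E : measurable E -> measurable_fun [set: borel G] (fun g => l g E).
  apply: measurable_measure_of_rect => [g|A B mA mB].
    by rewrite /l /= /pushforward preimage_setT probability_setT.
  exact: (mS A B mA mB).
have := measurable_fun_integral_kernel ml w0 mw => mI.
apply/measurable_EFinP.
apply: (eq_measurable_fun (fun g : borel G =>
    (\int[l g]_p (u p.1 * v p.2 + M)%:E - M%:E)%E)); last first.
  by apply: emeasurable_funB => //; exact: measurable_cst.
move=> g _; rewrite /l ge0_integral_pushforward//=.
transitivity (\int[nu]_y ((u (S g y) * v y)%:E + (cst M y)%:E) - M%:E)%E; first by [].
have iM : nu.-integrable [set: Y] (EFin \o cst M).
  apply: (bounded_measurable_integrable (probability_setT nu)).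
  exact: bounded_measurable_cst.
have -> : (\int[nu]_y ((u (S g y) * v y)%:E + (cst M y)%:E) =
    \int[nu]_y (u (S g y) * v y)%:E + M%:E)%E.
  rewrite (integralD measurableT (iwg g) iM); congr (_ + _)%E.
  transitivity (M%:E * nu setT)%E; first exact: (integral_cst nu measurableT M%:E).
  by rewrite probability_setT mule1.
rewrite addeK//.
by rewrite fineK//; exact: (integrable_fin_num measurableT (iwg g)).
Qed.

End correlation.

(** * Fiber maps over an ergodic skew product *)

Section skew.
Context dX (X : measurableType dX) dY (Y : measurableType dY) (R : realType).
Context (G : topologicalZmodType).
Variables (mu : probability X R) (nu : probability Y R).
Variables (T : X -> X) (phi : X -> G) (S : G -> Y -> Y).
Local Notation mn := (mu \x nu)%E.
Local Notation U := (skew_product T phi S).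
Hypothesis actS : measurable_action nu S.
Hypothesis ergU : ergodic mn U.

Let mn1 := product_measure1_setT mu nu.
Let mu1 : (mu : {measure set X -> \bar R}) [set: X] = 1%E := probability_setT mu.
Let nu1 : (nu : {measure set Y -> \bar R}) [set: Y] = 1%E := probability_setT nu.

Lemma measure_preserving_action g : measure_preserving nu (S g).
Proof. by case: actS => aS _ _; case: (aS g). Qed.

Definition fiber_map (g : G) (p : X * Y) : X * Y := (p.1, S g p.2).

Lemma measure_preserving_fiber_map g : measure_preserving mn (fiber_map g).
Proof.
have [mS SE] := measure_preserving_action g.
have mf : measurable_fun [set: X * Y] (fiber_map g).
  apply: measurable_fun_pair; first exact: measurable_fst.
  exact: measurableT_comp mS measurable_snd.
split=> // A mA; rewrite /product_measure1; apply: eq_integral => x _ /=.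
rewrite -[RHS]SE; last exact: measurable_xsection.
by rewrite !xsectionE.
Qed.

(** Over a fixed x both sides involve [S (g + phi x)], by commutativity of [G]. The identity is
    composed with [F] so that it becomes an equation in [R[i]], whose solution set is measurable. *)
Lemma fiber_mapC_ae g (F : X * Y -> R[i]) :
  measurable_fun [set: X * Y] (F : X * Y -> borelC R) ->
  {ae mn, forall p, F (fiber_map g (U p)) = F (U (fiber_map g p))}.
Proof.
move=> mF; have [mf _] := measure_preserving_fiber_map g.
have mU : measurable_fun [set: X * Y] U := ergU.1.1.
apply: ae_of_xsection.
  by apply: measurable_eqC; [exact: measurableT_comp mF (measurableT_comp mf mU)|
    exact: measurableT_comp mF (measurableT_comp mU mf)].
move=> x; case: actS => _ SD _.
apply: filterS2 (SD g (phi x)) (SD (phi x) g) => y.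
by rewrite addrC /fiber_map /skew_product /= => <- <-.
Qed.

(** The action inherits ergodicity: viewed on the product, [k] is invariant under the skew product,
    which moves the second coordinate by [S (phi x)]. *)
Lemma action_invariant_cst (k : Y -> R[i]) : bounded_measurableC k ->
  (forall g, {ae nu, forall y, k (S g y) = k y}) ->
  exists c, {ae nu, forall y, k y = c}.
Proof.
move=> bk kS.
have bK : bounded_measurableC (fun p : X * Y => k p.2).
  exact: bounded_measurableC_comp bk measurable_snd.
have mK := measurable_of_bounded_measurableC bK.
have KU : {ae mn, forall p, k (U p).2 = k p.2}.
  apply: ae_of_xsection => [|x]; last exact: (kS (phi x)).
  by apply: measurable_eqC => //; exact: measurableT_comp mK ergU.1.1.
have [c kc] := ergodic_bounded_cst ergU mn1 bK KU.
exists c; exact: (ae_of_snd (P := fun y => k y = c) kc).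
Qed.

Lemma bounded_measurableC_partial (F : X * Y -> R[i]) : bounded_measurableC F ->
  bounded_measurableC (fun y => Cintegral mu (fun x => F (x, y))) /\
  bounded_measurableC (fun x => Cintegral nu (fun y => F (x, y))).
Proof.
move=> [bR bI]; have [b1 b2 _ _] := Fubini_Rintegral mu nu bR.
by have [b3 b4 _ _] := Fubini_Rintegral mu nu bI.
Qed.

Lemma Cintegral_Fubini (F : X * Y -> R[i]) : bounded_measurableC F ->
  Cintegral nu (fun y => Cintegral mu (fun x => F (x, y))) =
  Cintegral mu (fun x => Cintegral nu (fun y => F (x, y))).
Proof.
move=> [bR bI]; have [_ _ R1 R2] := Fubini_Rintegral mu nu bR.
have [_ _ I1 I2] := Fubini_Rintegral mu nu bI.
by rewrite /Cintegral /= R1 R2 I1 I2.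
Qed.

(** The function q_A of the overview. The indicator is a weight, not a restriction of the domain, so
    that the integrand is again a bounded measurable function on the whole product. *)
Definition weighted_partial (A : set X) (F : X * Y -> R[i]) (y : Y) : R[i] :=
  Cintegral mu (fun x => ((\1_A x)%:C)%C * F (x, y)).

Lemma bounded_measurableC_indic (A : set X) : measurable A ->
  bounded_measurableC (fun x => ((\1_A x : R)%:C)%C).
Proof.
move=> mA; split; first exact: bounded_measurable_indic.
exact: bounded_measurable_cst.
Qed.

Lemma bounded_measurableC_weight (A : set X) (F : X * Y -> R[i]) :
  measurable A -> bounded_measurableC F ->
  bounded_measurableC (fun p => ((\1_A p.1)%:C)%C * F p).
Proof.
move=> mA bF; apply: bounded_measurableCM => //.
exact: (bounded_measurableC_comp (bounded_measurableC_indic mA) measurable_fst).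
Qed.

Lemma bounded_measurableC_weighted_partial (A : set X) (F : X * Y -> R[i]) :
  measurable A -> bounded_measurableC F -> bounded_measurableC (weighted_partial A F).
Proof.
move=> mA bF.
by have [] := bounded_measurableC_partial (bounded_measurableC_weight mA bF).
Qed.

Lemma weighted_partial_fiber_map (A : set X) (F : X * Y -> R[i]) g z :
  measurable A -> bounded_measurableC F ->
  {ae mn, forall p, F (fiber_map g p) = z * F p} ->
  {ae nu, forall y, weighted_partial A F (S g y) = z * weighted_partial A F y}.
Proof.
move=> mA bF Fg.
have bw := bounded_measurableC_weight mA bF.
have bwy y : bounded_measurableC (fun x => ((\1_A x)%:C)%C * F (x, y)).
  by apply: (bounded_measurableC_comp bw); exact: pair2_measurable.
apply: filterS (ae_ysection Fg) => y Fy.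
rewrite /weighted_partial -CintegralZl//.
apply: ae_eq_Cintegral => //.
  by apply: bounded_measurableCM => //; exact: bounded_measurableC_cst.
by apply: filterS Fy => x /= ->; rewrite mulrCA.
Qed.

Lemma ae_eq0_of_weighted_partial (F : X * Y -> R[i]) : bounded_measurableC F ->
  (forall A, measurable A -> {ae nu, forall y, weighted_partial A F y = 0}) ->
  {ae mn, forall p, F p = 0}.
Proof.
move=> [bR bI] F0.
have R0 : {ae mn, forall p, complex.Re (F p) = 0}.
  apply: ae_eq0_of_partial_integrals => // A /F0; apply: filterS => y.
  move=> /(congr1 (@complex.Re R)) /= <-; apply: eq_Rintegral => x _.
  by rewrite ReM /= mul0r subr0.
have I0 : {ae mn, forall p, complex.Im (F p) = 0}.
  apply: ae_eq0_of_partial_integrals => // A /F0; apply: filterS => y.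
  move=> /(congr1 (@complex.Im R)) /= <-; apply: eq_Rintegral => x _.
  by rewrite ImM /= mul0r addr0.
by apply: filterS2 R0 I0 => p ? ?; exact: complex_eq.
Qed.

(** With [k] the average of [F] over y, the claim is that [F - k] vanishes. Each partial integral of
    [F] over a set [A] is invariant under [S], hence constant, and Fubini identifies the constant as
    the integral of [k] over [A]; so all partial integrals of [F - k] are 0. *)
Lemma fiber_invariant_fst (F : X * Y -> R[i]) : bounded_measurableC F ->
  (forall g, {ae mn, forall p, F (fiber_map g p) = F p}) ->
  {ae mn, forall p, F p = Cintegral nu (fun y => F (p.1, y))}.
Proof.
move=> bF Fg; pose k x := Cintegral nu (fun y => F (x, y)).
have bk : bounded_measurableC k := (bounded_measurableC_partial bF).2.
have bkp : bounded_measurableC (fun p : X * Y => - 1 * k p.1).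
  apply: bounded_measurableCM; first exact: bounded_measurableC_cst.
  exact: bounded_measurableC_comp bk measurable_fst.
pose H p := F p + -1 * k p.1.
have bH : bounded_measurableC H.
  case: bF bkp => [bR bI] [bR' bI']; split.
    by under [X in bounded_measurable X]eq_fun do rewrite raddfD;
      exact: bounded_measurableD.
  by under [X in bounded_measurable X]eq_fun do rewrite raddfD;
    exact: bounded_measurableD.
suff H0 : {ae mn, forall p, H p = 0}.
  by apply: filterS H0 => p /eqP; rewrite /H mulN1r subr_eq0 => /eqP.
apply: ae_eq0_of_weighted_partial => // A mA.
have bA := bounded_measurableC_weighted_partial mA bF.
have [g|c cA] := action_invariant_cst bA.
  have := @weighted_partial_fiber_map A F g 1 mA bF.
  have : {ae mn, forall p, F (fiber_map g p) = 1 * F p}.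
    by apply: filterS (Fg g) => p; rewrite mul1r.
  by move=> /[swap]/[apply]; apply: filterS => y; rewrite mul1r.
have bw := bounded_measurableC_weight mA bF.
have cE : c = Cintegral mu (fun x => ((\1_A x)%:C)%C * k x).
  transitivity (Cintegral nu (fun=> c)).
    apply: complex_eq; rewrite /Cintegral /=.
      by rewrite Rintegral_cst// [X in fine X]nu1 mulr1.
    by rewrite Rintegral_cst// [X in fine X]nu1 mulr1.
  transitivity (Cintegral nu (weighted_partial A F)).
    apply: ae_eq_Cintegral => //; first exact: bounded_measurableC_cst.
    by apply: filterS cA => y ->.
  rewrite (Cintegral_Fubini bw) /=; congr Cintegral; apply/funext => x.
  rewrite CintegralZl//.
  by apply: (bounded_measurableC_comp bF); exact: pair1_measurable.
apply: filterS cA => y Fy.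
transitivity (weighted_partial A F y -
    Cintegral mu (fun x => ((\1_A x)%:C)%C * k x)); last first.
  by rewrite Fy cE subrr.
have bwy : bounded_measurableC (fun x => ((\1_A x)%:C)%C * F (x, y)).
  by apply: (bounded_measurableC_comp bw); exact: pair2_measurable.
have bwk : bounded_measurableC (fun x => ((\1_A x)%:C)%C * k x).
  by apply: bounded_measurableCM => //; exact: bounded_measurableC_indic.
have E x : ((\1_A x)%:C)%C * H (x, y) =
    ((\1_A x)%:C)%C * F (x, y) - ((\1_A x)%:C)%C * k x.
  by rewrite /H mulrDr mulN1r mulrN.
case: bwy bwk => bR bI [bR' bI']; apply: complex_eq; rewrite raddfB /=.
  under eq_Rintegral do rewrite E raddfB.
  by rewrite (RintegralB measurableT (bounded_measurable_integrable mu1 bR)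
    (bounded_measurable_integrable mu1 bR')).
under eq_Rintegral do rewrite E raddfB.
by rewrite (RintegralB measurableT (bounded_measurable_integrable mu1 bI)
  (bounded_measurable_integrable mu1 bI')).
Qed.

End skew.

(** * Factors of an eigenfunction, and the converse construction *)

Section factorisation.
Context dX (X : measurableType dX) dY (Y : measurableType dY) (R : realType).
Context (G : topologicalZmodType).
Variables (mu : probability X R) (nu : probability Y R).
Variables (T : X -> X) (phi : X -> G) (S : G -> Y -> Y).
Local Notation mn := (mu \x nu)%E.
Local Notation U := (skew_product T phi S).
Hypothesis actS : measurable_action nu S.
Hypothesis ergU : ergodic mn U.

Let mn1 := product_measure1_setT mu nu.
Let mu1 : (mu : {measure set X -> \bar R}) [set: X] = 1%E := probability_setT mu.
Let nu1 : (nu : {measure set Y -> \bar R}) [set: Y] = 1%E := probability_setT nu.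

Lemma ae_ex d (Z : measurableType d) (m : {measure set Z -> \bar R})
    (P : Z -> Prop) :
  m [set: Z] = 1%E -> {ae m, forall z, P z} -> exists z, P z.
Proof.
move=> m1 Pae; have : (0 < m [set: Z])%E by rewrite m1.
move=> /ae_properfilter_algebraOfSetsType PF.
exact: (@filter_ex _ _ PF _ Pae).
Qed.

Lemma normC1_conj (z : R[i]) : `|z| = 1 -> z * z^* = 1.
Proof. by move=> z1; rewrite -normCK z1 expr1n. Qed.

(** The quotient of the translated function by [F], written with the conjugate since [F] is
    unimodular, is invariant: its two factors pick up [c] and [c^*], and [|c| = 1]. *)
Lemma unimodular_fiber_eigenvalue (c : R[i]) (F : X * Y -> R[i]) g :
  `|c| = 1 -> (forall p, `|F p| = 1) -> bounded_measurableC F ->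
  {ae mn, forall p, F (U p) = c * F p} ->
  exists z, {ae mn, forall p, F (fiber_map S g p) = z * F p}.
Proof.
move=> c1 F1 bF FU; have mF := measurable_of_bounded_measurableC bF.
have gp := measure_preserving_fiber_map mu actS g.
have bH : bounded_measurableC (fun p => F (fiber_map S g p) * (F p)^*).
  apply: bounded_measurableCM; first exact: bounded_measurableC_comp bF gp.1.
  exact: bounded_measurableC_conj.
have [|z Hz] := ergodic_bounded_cst ergU mn1 bH.
  have := fiber_mapC_ae actS ergU g mF.
  have := ae_measure_preserving gp FU.
  apply: filterS3 FU => p FUp -> ->.
  by rewrite FUp rmorphM mulrACA normC1_conj// mul1r.
exists z; apply: filterS Hz => p <-.
by rewrite -mulrA [_^* * _]mulrC normC1_conj// mulr1.
Qed.

Lemma fiber_eigenvalue_hom (chi : G -> R[i]) (F : X * Y -> R[i]) :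
  (forall p, `|F p| = 1) -> bounded_measurableC F ->
  (forall g, {ae mn, forall p, F (fiber_map S g p) = chi g * F p}) ->
  (forall g, `|chi g| = 1) /\ (forall g h, chi (g + h) = chi g * chi h).
Proof.
move=> F1 bF Fg; have mF := measurable_of_bounded_measurableC bF.
have F0 p : F p != 0 by rewrite -normr_eq0 F1 oner_eq0.
have mf g : measurable_fun [set: X * Y] (fiber_map S g).
  by case: (measure_preserving_fiber_map mu actS g).
split=> [g|g h].
  have [p /(congr1 Num.norm)] := ae_ex mn1 (Fg g).
  by rewrite normrM !F1 mulr1.
have SD : {ae mn, forall p, F (fiber_map S (g + h) p) =
    F (fiber_map S g (fiber_map S h p))}.
  apply: ae_of_xsection => [|x].
    apply: measurable_eqC; first exact: measurableT_comp mF (mf (g + h)).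
    exact: measurableT_comp mF (measurableT_comp (mf g) (mf h)).
  by case: actS => _ D _; apply: filterS (D g h) => y; rewrite /fiber_map /= => ->.
have gp := measure_preserving_fiber_map mu actS h.
have Fgh := ae_measure_preserving gp (Fg g).
have : {ae mn, forall p, chi (g + h) = chi g * chi h}.
  have Q : {ae mn, forall p, chi (g + h) * F p = chi g * F (fiber_map S h p)}.
    by apply: filterS3 (Fg (g + h)) SD Fgh => p <- -> ->.
  apply: filterS2 Q (Fg h) => p + Fhp.
  by rewrite Fhp mulrA => /(mulIf (F0 p)).
by case/(ae_ex mn1).
Qed.

(** Since [|g| = 1], [chi h] is the integral of [g (S h y) * (g y)^*]. Its real and imaginary parts
    split into real correlations, each Borel in [h]. *)
Lemma action_eigenvalue_continuous (chi : G -> R[i]) (g : Y -> R[i]) :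
  hausdorff_space G -> locally_compact [set: G] ->
  (forall h, `|chi h| = 1) -> (forall h h', chi (h + h') = chi h * chi h') ->
  bounded_measurableC g -> {ae nu, forall y, `|g y| = 1} ->
  (forall h, {ae nu, forall y, g (S h y) = chi h * g y}) ->
  continuous (chi : G -> R[i]^o).
Proof.
move=> hG lG chi1 chiD bg g1 gS.
have mS h : measurable_fun [set: Y] (S h) by case: (measure_preserving_action actS h).
have bgS h : bounded_measurableC (fun y => g (S h y) * (g y)^*).
  apply: bounded_measurableCM; first exact: bounded_measurableC_comp bg (mS h).
  exact: bounded_measurableC_conj.
have chiE h : chi h = Cintegral nu (fun y => g (S h y) * (g y)^*).
  transitivity (Cintegral nu (fun=> chi h)).
    by apply: complex_eq; rewrite /Cintegral /= Rintegral_cst// [X in fine X]nu1 mulr1.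
  apply: ae_eq_Cintegral => //; first exact: bounded_measurableC_cst.
  by apply: filterS2 g1 (gS h) => y y1 ->; rewrite -mulrA normC1_conj// mulr1.
case: (bg) => bR bI.
have bRS h := bounded_measurable_comp bR (mS h).
have bIS h := bounded_measurable_comp bI (mS h).
have i (u v : Y -> R) (bu : bounded_measurable u) (bv : bounded_measurable v) :=
  bounded_measurable_integrable nu1 (bounded_measurableM bu bv).
apply: measurable_hom_continuous => //.
  apply: (eq_measurable_fun (fun h : borel G =>
    \int[nu]_y (complex.Re (g (S h y)) * complex.Re (g y)) +
    \int[nu]_y (complex.Im (g (S h y)) * complex.Im (g y)))).
    move=> h _; rewrite chiE /Cintegral /=.
    under [RHS]eq_Rintegral do rewrite ReM Re_conj Im_conj mulrN opprK.
    by rewrite (RintegralD measurableT (i _ _ (bRS h) bR) (i _ _ (bIS h) bI)).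
  by apply: measurable_funD; [exact: (measurable_correlation actS bR bR)|
    exact: (measurable_correlation actS bI bI)].
apply: (eq_measurable_fun (fun h : borel G =>
  \int[nu]_y (complex.Im (g (S h y)) * complex.Re (g y)) -
  \int[nu]_y (complex.Re (g (S h y)) * complex.Im (g y)))).
  move=> h _; rewrite chiE /Cintegral /=.
  under [RHS]eq_Rintegral do rewrite ImM Re_conj Im_conj mulrN addrC.
  by rewrite (RintegralB measurableT (i _ _ (bIS h) bR) (i _ _ (bRS h) bI)).
by apply: measurable_funB; [exact: (measurable_correlation actS bI bR)|
  exact: (measurable_correlation actS bR bI)].
Qed.

Lemma unimodular_factorisation (c : R[i]) (F : X * Y -> R[i]) :
  hausdorff_space G -> locally_compact [set: G] ->
  `|c| = 1 -> (forall p, `|F p| = 1) -> bounded_measurableC F ->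
  {ae mn, forall p, F (U p) = c * F p} ->
  exists chi f g,
    [/\ character chi, (forall x, `|f x| = 1) /\ bounded_measurableC f,
      bounded_measurableC g /\ {ae nu, forall y, `|g y| = 1},
      forall h, {ae nu, forall y, g (S h y) = chi h * g y} &
      {ae mn, forall p, F p = f p.1 * g p.2}].
Proof.
move=> hG lG c1 F1 bF FU.
have /choice[chi Fchi] := fun h => unimodular_fiber_eigenvalue h c1 F1 bF FU.
have [chi1 chiD] := fiber_eigenvalue_hom F1 bF Fchi.
have [A [mA nA]] : exists A, measurable A /\
    ~ {ae nu, forall y, weighted_partial mu A F y = 0}.
  apply: contrapT => /forallNP hA.
  have [A mA|p Fp0] := ae_ex mn1 (ae_eq0_of_weighted_partial (mu := mu) (nu := nu) bF _).
    by have /not_andP[//|/contrapT] := hA A.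
  by have /eqP := F1 p; rewrite Fp0 normr0 eq_sym oner_eq0.
pose q := weighted_partial mu A F.
have bq : bounded_measurableC q := bounded_measurableC_weighted_partial mu nu mA bF.
have qS h : {ae nu, forall y, q (S h y) = chi h * q y}.
  exact: weighted_partial_fiber_map.
have bqq : bounded_measurableC (fun y => q y * (q y)^*).
  by apply: bounded_measurableCM => //; exact: bounded_measurableC_conj.
have [h|b qb] := action_invariant_cst ergU bqq.
  apply: filterS (qS h) => y ->.
  by rewrite rmorphM mulrACA (normC1_conj (chi1 h)) mul1r.
have [y0 qy0] := ae_ex nu1 qb.
have b_ge0 : 0 <= b by rewrite -qy0 mul_conjC_ge0.
have b_neq0 : b != 0.
  apply/eqP => b0; apply: nA; apply: filterS qb => y.
  by rewrite b0 => /eqP; rewrite mul_conjC_eq0 => /eqP.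
pose s := Num.sqrt (complex.Re b).
have bE : b = (complex.Re b)%:C%C.
  by apply: complex_eq => //=; case: (b) b_ge0 => x y; rewrite lecE => /andP[/eqP].
have Rb0 : 0 < complex.Re b.
  by rewrite -ltcR -bE lt_def b_neq0.
have s0 : 0 < s by rewrite sqrtr_gt0.
have sb : (s%:C ^+ 2)%C = b.
  by rewrite [RHS]bE -rmorphXn /= sqr_sqrtr// ltW.
have sC0 : 0 <= (s%:C)%C :> R[i] by rewrite lecR ltW.
have sCn0 : (s%:C)%C != 0 :> R[i] by rewrite fmorph_eq0 gt_eqF.
have qs : {ae nu, forall y, `|q y| = (s%:C)%C}.
  apply: filterS qb => y; rewrite -normCK -sb => /eqP.
  by rewrite eqrXn2// => /eqP.
pose K p := F p * (q p.2)^*.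
have bK : bounded_measurableC K.
  apply: bounded_measurableCM => //; apply: bounded_measurableC_conj.
  exact: bounded_measurableC_comp bq measurable_snd.
have KS h : {ae mn, forall p, K (fiber_map S h p) = K p}.
  apply: filterS2 (Fchi h) (ae_snd mu (qS h)) => p Fp qp.
  by rewrite /K Fp /= qp rmorphM mulrACA (normC1_conj (chi1 h)) mul1r.
have Kk := fiber_invariant_fst ergU bK KS.
pose k x := Cintegral nu (fun y => K (x, y)).
have bk : bounded_measurableC k := (bounded_measurableC_partial mu nu bK).2.
(* Multiplying [K = k] by [q] turns [q * q^*] into the constant [b = s ^+ 2]; taking norms then
   gives [|k| = s]. *)
have Fk : {ae mn, forall p, F p * b = k p.1 * q p.2}.
  apply: filterS2 Kk (ae_snd mu qb) => p; rewrite -/(k p.1) => <- <-.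
  by rewrite /K -!mulrA; congr (_ * _); rewrite mulrC.
have ks : {ae mu, forall x, `|k x| = (s%:C)%C}.
  apply: (ae_of_fst (nu := nu)); apply: filterS2 Fk (ae_snd mu qs) => p.
  move=> /(congr1 Num.norm); rewrite !normrM F1 mul1r -sb normrX ger0_norm// => + qp.
  by rewrite qp expr2 => /(mulIf sCn0).
(* Dividing [b = s ^+ 2] evenly makes both [k / s] and [q / s] unimodular. The first must be so at
   every point, as [cohomologous_via] demands, hence [unimodular_part]. *)
exists chi, (unimodular_part s k), (fun y => q y / (s%:C)%C).
have bg : bounded_measurableC (fun y => q y / (s%:C)%C).
  by apply: bounded_measurableCM => //; exact: bounded_measurableC_cst.
have g1 : {ae nu, forall y, `|q y / (s%:C)%C| = 1}.
  by apply: filterS qs => y qy; rewrite normrM qy normfV ger0_norm// divff.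
have gS h : {ae nu, forall y, q (S h y) / (s%:C)%C = chi h * (q y / (s%:C)%C)}.
  by apply: filterS (qS h) => y ->; rewrite mulrA.
split => //.
- by split => //; exact: (action_eigenvalue_continuous hG lG chi1 chiD bg g1 gS).
- split; first by move=> x; exact: unimodular_part_norm.
  by apply: bounded_measurableC_unimodular_part => //;
    exact: measurable_of_bounded_measurableC.
- apply: filterS2 Fk (ae_fst nu ks) => p + kp.
  rewrite {1}(unimodular_partE s0 kp) -sb => E.
  apply: (mulIf (expf_neq0 2 sCn0)); rewrite E.
  by rewrite expr2; field.
Qed.

Lemma eigenfunction_factorisation (c : R[i]) (t : R) (F : X * Y -> R[i]) :
  hausdorff_space G -> locally_compact [set: G] ->
  c = cis2pi t -> eigenfunction mn U c F ->
  exists (chi : G -> R[i]) (f : X -> R[i]) (g : Y -> R[i]),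
    [/\ cohomologous_via mu T phi t chi f, action_eigenfunction nu S chi g &
        {ae mn, forall p, F p = f p.1 * g p.2}].
Proof.
move=> hG lG ct [c1 [mF F2] Fn0 FU].
(* The squared modulus is the quantity that membership in L^2 makes integrable; its constant value
   [a] gives the modulus [r] of [F]. *)
pose N p := complex.Re `|F p| ^+ 2.
have NE p : N p = complex.Re (F p) ^+ 2 + complex.Im (F p) ^+ 2.
  by rewrite /N normc_def /= sqr_sqrtr// addr_ge0// sqr_ge0.
have [mR mI] := (measurable_Re mF, measurable_Im mF).
have mN : measurable_fun [set: X * Y] N.
  rewrite (_ : N = fun p => complex.Re (F p) ^+ 2 + complex.Im (F p) ^+ 2).
    by apply: measurable_funD; exact: measurable_funX.
  exact/funext.
have iN : mn.-integrable [set: X * Y] (EFin \o N).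
  apply/integrableP; split; first exact/measurable_EFinP.
  rewrite (eq_integral (fun p => (complex.Re `|F p| ^+ 2)%:E))// => p _.
  by rewrite /= ger0_norm// sqr_ge0.
have NU : {ae mn, forall p, N (U p) = N p}.
  by apply: filterS FU => p; rewrite /N => ->; rewrite normrM c1 mul1r.
have [a Na] := ergodic_integrable_cst ergU mn1 iN NU.
have a0 : 0 < a.
  have [p Np] := ae_ex mn1 Na; rewrite lt_def -{2}Np sqr_ge0 andbT.
  apply/eqP => a0; apply: Fn0; apply: filterS Na => z.
  rewrite NE a0 => /eqP; rewrite paddr_eq0 ?sqr_ge0// !sqrf_eq0.
  by move=> /andP[/eqP ? /eqP ?]; exact: complex_eq.
pose r := Num.sqrt a; have r0 : 0 < r by rewrite sqrtr_gt0.
have rn0 : (r%:C)%C != 0 :> R[i] by rewrite fmorph_eq0 gt_eqF.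
have Fr : {ae mn, forall p, F p = (r%:C)%C * unimodular_part r F p}.
  apply: filterS Na => p Np; apply: unimodular_partE => //.
  by apply/eqP; rewrite norm_complex_sqr ?ltW// -NE Np sqr_sqrtr// ltW.
pose F' := unimodular_part r F.
have F'1 p : `|F' p| = 1 by exact: unimodular_part_norm.
have bF' : bounded_measurableC F' by exact: bounded_measurableC_unimodular_part.
have F'U : {ae mn, forall p, F' (U p) = c * F' p}.
  have := ae_measure_preserving ergU.1 Fr.
  apply: filterS3 FU Fr => p + Fp FUp; rewrite FUp Fp mulrCA.
  exact: mulfI.
have [chi [f [g [chiC [f1 bf] [bg g1] gS Ffg]]]] :=
  unimodular_factorisation hG lG c1 F'1 bF' F'U.
(* The modulus [r] goes to the factor on [Y], because the transfer function must stay on the unit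
   circle. *)
exists chi, f, (fun y => (r%:C)%C * g y).
have f0 x : f x != 0 by rewrite -normr_eq0 f1 oner_eq0.
have mg' : bounded_measurableC (fun y => (r%:C)%C * g y).
  by apply: bounded_measurableCM => //; exact: bounded_measurableC_cst.
split.
- split => //; first exact: measurable_of_bounded_measurableC.
  have FfgU := ae_measure_preserving ergU.1 Ffg.
  have Q : {ae mn, forall p, f (T p.1) * g (S (phi p.1) p.2) = c * (f p.1 * g p.2)}.
    by apply: filterS3 Ffg FfgU F'U => p /= -> ->.
  (* For such an x a single good y suffices: the eigenfunction equation at [phi x] replaces
     [g (S (phi x) y)] by [chi (phi x) * g y], and [g y] cancels. *)
  apply: filterS (ae_xsection Q) => x Qx.
  have [y [[]]] := ae_ex nu1 (filterI (filterI Qx g1) (gS (phi x))).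
  move=> /= E gy1 gSy; move: E; rewrite gSy !mulrA.
  have gn0 : g y != 0 by rewrite -normr_eq0 gy1 oner_eq0.
  move=> /(mulIf gn0) E; rewrite -ct -E.
  by rewrite mulrAC divff// mul1r.
- split => //.
  + split; first exact: measurable_of_bounded_measurableC.
    rewrite (ae_eq_integral (cst (r ^+ 2)%:E)) ?integral_cst//.
    * by rewrite [X in (_ * X)%E]nu1 mule1 ltry.
    * apply/measurable_EFinP.
      rewrite (_ : (fun y => _) = (fun y => complex.Re ((r%:C)%C * g y) ^+ 2 +
        complex.Im ((r%:C)%C * g y) ^+ 2)).
        by case: mg' => -[? _] [? _]; apply: measurable_funD; exact: measurable_funX.
      by apply/funext => y; rewrite normc_def /= sqr_sqrtr// addr_ge0// sqr_ge0.
    * apply: filterS g1 => y gy _; congr EFin.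
      by rewrite normrM gy mulr1 ger0_norm// lecR ltW.
  + move=> g0; have [y [gy0 gy1]] := ae_ex nu1 (filterI g0 g1).
    move: gy0 => /eqP; rewrite mulf_eq0 (negPf rn0) /= => /eqP gy0.
    by move/eqP: gy1; rewrite gy0 normr0 eq_sym oner_eq0.
  + by move=> h; apply: filterS (gS h) => y ->; rewrite mulrCA.
- by apply: filterS2 Fr Ffg => p -> Fp; rewrite -/(F' p) Fp mulrCA.
Qed.

Lemma factor_eigenfunction (t : R) (chi : G -> R[i]) (f : X -> R[i])
    (g : Y -> R[i]) (F : X * Y -> R[i]) :
  measurable_fun [set: X] (phi : X -> borel G) ->
  measurable_fun [set: X * Y] (F : X * Y -> borelC R) ->
  cohomologous_via mu T phi t chi f -> action_eigenfunction nu S chi g ->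
  {ae mn, forall p, F p = f p.1 * g p.2} ->
  eigenfunction mn U (cis2pi t) F.
Proof.
move=> mphi mF [mf f1 fT] [[chiC chi1 chiD] [mg g2] gn0 gS] Ffg.
have f0 x : f x != 0 by rewrite -normr_eq0 f1 oner_eq0.
have msqr d (Z : measurableType d) (H : Z -> R[i]) :
    measurable_fun [set: Z] (H : Z -> borelC R) ->
    measurable_fun [set: Z] (fun z => (complex.Re `|H z| ^+ 2)%:E).
  move=> mH; apply/measurable_EFinP.
  rewrite (_ : (fun z => _) = (fun z => complex.Re (H z) ^+ 2 + complex.Im (H z) ^+ 2)).
    by apply: measurable_funD; apply: measurable_funX;
      [exact: measurable_Re|exact: measurable_Im].
  by apply/funext => z; rewrite normc_def /= sqr_sqrtr// addr_ge0// sqr_ge0.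
split.
- exact: norm_cis2pi.
- split => //.
  have mgp : measurable_fun [set: X * Y] ((fun p : X * Y => g p.2) : _ -> borelC R).
    exact: measurableT_comp mg measurable_snd.
  rewrite (ae_eq_integral (fun p => (complex.Re `|g p.2| ^+ 2)%:E)) //.
  + rewrite fubini_tonelli1; last 2 first.
    * exact: (msqr _ _ _ mgp).
    * by move=> p; rewrite lee_fin sqr_ge0.
    rewrite /fubini_F /= (eq_integral (cst (\int[nu]_y (complex.Re `|g y| ^+ 2)%:E)%E)) //.
    by rewrite integral_cst// [X in (_ * X)%E]mu1 mule1.
  + exact: msqr.
  + exact: msqr.
  + by apply: filterS Ffg => p -> _; rewrite normrM f1 mul1r.
- move=> F0; apply: gn0; apply: (ae_of_snd (mu := mu)).
  apply: filterS2 F0 Ffg => p -> /esym/eqP.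
  by rewrite mulf_eq0 (negPf (f0 _)) => /eqP.
(* The equation for [g] is used at the group element [phi x], which varies with x. Measurability of
   the set of pairs satisfying it rests on [chi] being Borel, by continuity, and on [phi] being
   measurable. *)
- have gU : {ae mn, forall p, g (U p).2 = chi (phi p.1) * g p.2}.
    apply: ae_of_xsection => [|x]; last exact: (gS (phi x)).
    apply: measurable_eqC.
      exact: measurableT_comp (measurableT_comp mg measurable_snd) ergU.1.1.
    apply: measurable_funCM; last exact: measurableT_comp mg measurable_snd.
    have mchi : measurable_fun [set: borel G] (chi : borel G -> borelC R).
      apply: (@measurability _ _ (borel G) (borelC R) setT chi open) => //.
      move=> _ [V oV <-]; rewrite setTI; apply: sub_sigma_algebra.
      exact: (open_comp (fun x _ => chiC x) oV).
    exact: measurableT_comp mchi (measurableT_comp mphi measurable_fst).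
  have FfgU := ae_measure_preserving ergU.1 Ffg.
  have fT' := ae_fst nu fT.
  apply: filterS2 (filterI Ffg FfgU) (filterI gU fT') => p [Fp FUp] [gp fp].
  rewrite FUp gp Fp fp /=.
  by field.
Qed.

End factorisation.

Theorem proposition6 (R : realType)
  (dX : measure_display) (X : measurableType dX) (mu : probability X R)
  (T : X -> X)
  (G : topologicalZmodType) (phi : X -> G)
  (dY : measure_display) (Y : measurableType dY) (nu : probability Y R)
  (S : G -> Y -> Y) :
  standard_borel R X -> standard_borel R Y ->
  automorphism mu T ->
  hausdorff_space G -> locally_compact [set: G] -> @second_countable G ->
  measurable_fun [set: X] (phi : X -> borel G) ->
  measurable_action nu S ->
  ergodic (mu \x nu)%E (skew_product T phi S) ->
  (forall F : X * Y -> R[i],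
     measurable_fun [set: X * Y] (F : X * Y -> borelC R) ->
     ((exists c, eigenfunction (mu \x nu)%E (skew_product T phi S) c F) <->
      (exists (t : R) (chi : G -> R[i]) (f : X -> R[i]) (g : Y -> R[i]),
         [/\ 0 <= t < 1, cohomologous_via mu T phi t chi f,
             action_eigenfunction nu S chi g &
             {ae (mu \x nu)%E, forall p, F p = f p.1 * g p.2}]))) /\
  (forall t : R, 0 <= t < 1 ->
     (L2_eigenvalue (mu \x nu)%E (skew_product T phi S) (cis2pi t) <->
      exists2 chi, action_eigenvalue nu S chi &
        cohomologous_characters mu T phi t chi)).
Proof.
move=> _ _ _ hG lG _ mphi actS ergU; split=> [F mF|t _]; split.
- move=> [c eF]; have [t t01 ct] := cis2pi_surj (let: And4 c1 _ _ _ := eF in c1).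
  have [chi [f [g [fT gS Ffg]]]] := eigenfunction_factorisation actS ergU hG lG ct eF.
  by exists t, chi, f, g.
- move=> [t [chi [f [g [_ fT gS Ffg]]]]]; exists (cis2pi t).
  exact: factor_eigenfunction fT gS Ffg.
- move=> [F eF].
  have [chi [f [g [fT gS _]]]] :=
    eigenfunction_factorisation actS ergU hG lG (erefl _) eF.
  exists chi; first by exists g.
  by split; [case: gS|exists f].
- move=> [chi [g gS] [_ [f fT]]]; exists (fun p => f p.1 * g p.2).
  apply: (factor_eigenfunction ergU mphi _ fT gS); last exact: aeW.
  have [mf _ _] := fT; have [_ [mg _] _ _] := gS.
  by apply: measurable_funCM; [exact: measurableT_comp mf measurable_fst|
    exact: measurableT_comp mg measurable_snd].
Qed.
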